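(* Let $(X,a,t)$ be an oriented $\mathrm{el}_2^{RO}$-algebra. Suppose that $X(1)_*$ is graded-connected as an $\mathbb F_2$-algebra. Let $(y_i)_{i\in I}$ be a family of homogeneous elements of $X(C)_*$ of positive degree such that $\Phi^C_*X$ is a polynomial algebra over $X(1)_*$ on the classes $y_i/1$ for $i\in I$ and the class $t/a$. Then the class $1$ and the classes $\Gamma^n(y_{i_1}\cdot\ldots\cdot y_{i_r})$ for all $n\geq0$, $r\geq1$ and all unordered $r$-tuples (multisets) $\{i_1,\dots,i_r\}$ of elements of $I$ form a basis of $X(C)_*$ as a graded module over $X(1)_*$.
   Context: Write $C=\{\pm1\}$. An elementary abelian 2-group is a finite group isomorphic to $C^n$ for some $n\ge 0$. Representations are finite-dimensional and real. A character of $A$ is a homomorphism $\lambda:A\to C$, identified with the 1-dimensional representation on $\mathbb R$ with $g\cdot x=\lambda(g)x$ and with its class in the real representation ring $RO(A)$; $\sigma$ is the sign representation of $C$ (the identity character). For a finite group $G$ put $I_G=\{k-V: k\in\mathbb Z,\ V \text{ a } G\text{-representation}\}\subset RO(G)$. The category $\mathrm{el}_2^{RO}$ has objects the pairs $(A,m)$ with $A$ an elementary abelian 2-group and $m\in I_A$; morphisms $(B,n)\to(A,m)$ are group homomorphisms $\alpha:B\to A$ with $\alpha^*(m)=n$. It is symmetric monoidal under $(A,m)\times(B,n)=(A\times B,\,p_1^*(m)+p_2^*(n))$ with unit $(1,0)$. An $\mathrm{el}_2^{RO}$-algebra is a lax symmetric monoidal functor $X:(\mathrm{el}_2^{RO})^{\mathrm{op}}\to(\mathbb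 F_2\text{-vector spaces},\otimes)$. Write $\alpha^*:X(A,m)\to X(B,\alpha^*(m))$ for the restriction maps, and $\mathrm{res}^A_B$ for restriction to a subgroup. Composing the monoidal pairing with restriction along the diagonal of $A$ gives products $X(A,m)\otimes X(A,n)\to X(A,m+n)$, making $X(A,\star)$ a commutative $I_A$-graded $\mathbb F_2$-algebra; its integer graded subring is $X(A)_*$, $X(A)_k=X(A,k)$. An orientable $\mathrm{el}_2^{RO}$-algebra is a pair $(X,a)$ with $a\in X(C,-\sigma)$ such that for every elementary abelian 2-group $A$, every $m\in I_A$ and every nontrivial character $\lambda$ of $A$ with kernel $K$, the sequence $$0\to X(A,m)\xrightarrow{a_\lambda\cdot-}X(A,m-\lambda)\xrightarrow{\mathrm{res}^A_K}X(K,\mathrm{res}^A_K(m)-1)\to 0$$ is exact, where $a_\lambda=\lambda^*(a)$. An inverse Thom class is a class $t\in X(C,1-\sigma)$ with $\mathrm{res}^C_1(t)=1\in X(1,0)$. An oriented $\mathrm{el}_2^{RO}$-algebra is a triple $(X,a,t)$ with $(X,a)$ orientable and $t$ an inverse Thom class. The geometric fixed point ring $\Phi^C_*X$ is the integer graded part of the localization of $X(C,\star)$ obtained by inverting $a$; degree $k$ elements are fractions $x/a^n$ with $x\in X(C,k-n\sigma)$. $X(1)_*$ acts on $X(C)_*$ and $\Phi^C_*X$ through inflation along $C\to 1$. Graded-connected means $X(1)_k=0$ for $k<0$ and $X(1)_0=\mathbb F_2$. The division operator $\Gamma:X(C)_k\to X(C)_{k+1}$ is the additive map characterized by $a\cdot\Gamma(x)=t\cdot(x+\epsilon^*(x))$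 in $X(C,k+1-\sigma)$, where $\epsilon:C\to C$ is the trivial homomorphism; existence and uniqueness of $\Gamma(x)$ follow from the exactness property. $\Gamma^n$ is its $n$-fold iterate. *)

(* Defs.v *)
From HB Require Import structures.
From mathcomp Require Import all_boot all_order all_algebra all_fingroup all_solvable.
From mathcomp Require Import mxrepresentation character generic_quotient.
From mathcomp Require Import finmap multiset.
From mathcomp Require Import boolp classical_sets functions cardinality fsbigop reals.
Set Implicit Arguments.
Unset Strict Implicit.
Unset Printing Implicit Defensive.
Import Order.TTheory GRing.Theory Num.Theory.
Local Open Scope mset_scope.
Local Open Scope ring_scope.

HB.instance Definition _ (gT : finGroupType) (G : {group gT}) :=
  isMultiplicative.Build (subg_of G) gT (@sgval gT G) (fun _ _ => erefl).

Lemma gmulf_ext (G H : finGroupType) (f g : {multiplicative G -> H}) :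
  f =1 g -> f = g.
Proof.
case: f g => [f [[fM]]] [g [[gM]]] /= /funext fg; rewrite fg in fM *.
by rewrite (Prop_irrelevance fM gM).
Qed.

Lemma gmulf_one (G H : finGroupType) (f : {multiplicative G -> H}) :
  f 1%g = 1%g.
Proof. by apply: (mulgI (f 1%g)); rewrite -gmulfM !mulg1. Qed.

(* Commutative Z-graded rings.  Products land in any degree k with a proof of
   i + j = k, which avoids casts. *)
Record graded_ring := GradedRing {
  gr_car :> int -> zmodType;
  gr_mul : forall i j k : int, i + j = k -> gr_car i -> gr_car j -> gr_car k;
  gr_one : gr_car 0;
  gr_mulDl : forall i j k (e : i + j = k) (x x' : gr_car i) (y : gr_car j),
    gr_mul e (x + x') y = gr_mul e x y + gr_mul e x' y;
  gr_mulC : forall i j k (e : i + j = k) (e' : j + i = k)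
      (x : gr_car i) (y : gr_car j),
    gr_mul e x y = gr_mul e' y x;
  gr_mulA : forall i j k ij jk l (e1 : i + j = ij) (e2 : ij + k = l)
      (e3 : j + k = jk) (e4 : i + jk = l)
      (x : gr_car i) (y : gr_car j) (z : gr_car k),
    gr_mul e2 (gr_mul e1 x y) z = gr_mul e4 x (gr_mul e3 y z);
  gr_mul1 : forall i (e : 0 + i = i) (x : gr_car i), gr_mul e gr_one x = x
}.
Arguments gr_mul {g i j k}.
Arguments gr_one {g}.

Record graded_hom (S T : graded_ring) := GradedHom {
  gh_fun :> forall k : int, {additive S k -> T k};
  gh_one : gh_fun 0 gr_one = gr_one;
  gh_mul : forall i j k (e : i + j = k) (x : S i) (y : S j),
    gh_fun k (gr_mul e x y) = gr_mul e (gh_fun i x) (gh_fun j y)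
}.

Lemma graded_hom_comp_one (S T U : graded_ring)
    (g : graded_hom T U) (f : graded_hom S T) : (g 0 \o f 0) gr_one = gr_one.
Proof. by rewrite /= !gh_one. Qed.
Lemma graded_hom_comp_mul (S T U : graded_ring)
    (g : graded_hom T U) (f : graded_hom S T) i j k (e : i + j = k)
    (x : S i) (y : S j) :
  (g k \o f k) (gr_mul e x y) = gr_mul e ((g i \o f i) x) ((g j \o f j) y).
Proof. by rewrite /= !gh_mul. Qed.
Definition graded_hom_comp (S T U : graded_ring)
    (g : graded_hom T U) (f : graded_hom S T) : graded_hom S U :=
  @GradedHom S U (fun k => g k \o f k) (graded_hom_comp_one g f)
    (graded_hom_comp_mul g f).

Record finsupp_family (B : choiceType) (V : B -> zmodType) := FinsuppFamily {
  ff_fun :> forall b : B, V b;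
  ff_finite : finite_set [set b | ff_fun b != 0]
}.

Section GradedAlgebra.
Variables (S T : graded_ring) (phi : graded_hom S T).

(* The combinations of degree k of homogeneous elements [v b] of degree [d b]
   have coefficients of degree [k - d b]. *)
Definition lincomb (B : choiceType) (d : B -> int) (v : forall b, T (d b))
    (k : int) (c : finsupp_family (fun b => S (k - d b))) : T k :=
  \sum_(b \in [set: B]) gr_mul (subrK (d b) k) (phi _ (c b)) (v b).

Definition graded_basis (B : choiceType) (d : B -> int)
    (v : forall b, T (d b)) : Prop :=
  forall (k : int) (x : T k), exists! c, lincomb v (k := k) c = x.

Section Monomials.
Variables (J : choiceType) (d : J -> int) (z : forall j, T (d j)).

Fixpoint degree_seq (s : seq J) : int :=
  if s is j :: s' then d j + degree_seq s' else 0.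
Fixpoint prod_seq (s : seq J) : T (degree_seq s) :=
  if s is j :: s' then gr_mul erefl (z j) (prod_seq s') else gr_one.

(* Finite multisets M over J are the monomials in the variables J; since T is
   commutative the order chosen in enumerating M is irrelevant. *)
Definition mdegree (M : {mset J}) : int := degree_seq (enum_mset M).
Definition monomial (M : {mset J}) : T (mdegree M) := prod_seq (enum_mset M).

(* Homogeneous polynomials of degree k over S, in variables indexed by J of
   degrees d, as finitely supported families of coefficients. *)
Definition gpoly (k : int) := finsupp_family (fun M => S (k - mdegree M)).
Definition gpoly_eval (k : int) (c : gpoly k) : T k := lincomb monomial c.

Definition polynomial_algebra_on : Prop :=
  forall k : int, bijective (@gpoly_eval k).
End Monomials.
End GradedAlgebra.

Record elab2 := Elab2 {
  elab2_group :> finGroupType;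
  elab2P : (2.-abelem [set: elab2_group])%g
}.

Lemma abelem2P (gT : finGroupType) :
  (forall x y : gT, commute x y) -> (forall x : gT, (x * x)%g = 1%g) ->
  (2.-abelem [set: gT])%g.
Proof.
move=> xC x2; apply/abelemP => //; split; last first.
  by move=> x _; rewrite expgS expg1 x2.
by apply/centsP => x _ y _; exact: xC.
Qed.

Lemma elab2C (A : elab2) (x y : A) : commute x y.
Proof.
have /abelemP [//|/centsP cA _] := elab2P A.
by apply: cA; rewrite inE.
Qed.

Lemma elab2_sqr (A : elab2) (x : A) : (x * x)%g = 1%g.
Proof.
have /abelemP [//|_ /(_ x)] := elab2P A.
by rewrite inE expgS expg1; apply.
Qed.

(* The group $C=\{\pm1\}$ is the additive group 'Z_2; the class of [c] stands
   for the sign [(-1) ^+ c]. *)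
Lemma elab2_sign_subproof : (2.-abelem [set: 'Z_2])%g.
Proof.
by apply: abelem2P => [x y|x]; apply/eqP; move: x; do ?move: y;
   do ?[case; case=> [|[|//]] ?].
Qed.
Definition elabC := Elab2 elab2_sign_subproof.

Lemma elab2_one_subproof : (2.-abelem [set: 'I_1])%g.
Proof. by apply: abelem2P => *; rewrite /commute ?ord1; apply: val_inj. Qed.
Definition elab1 := Elab2 elab2_one_subproof.

Lemma elab2_prod_subproof (A B : elab2) : (2.-abelem [set: (A * B)%type])%g.
Proof.
apply: abelem2P => [[x1 x2] [y1 y2]|[x1 x2]]; congr pair;
  by [exact: elab2C | exact: elab2_sqr].
Qed.
Definition elab2_prod (A B : elab2) := Elab2 (elab2_prod_subproof A B).

Lemma elab2_subg_subproof (A : elab2) (K : {group A}) :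
  (2.-abelem [set: subg_of K])%g.
Proof.
apply: abelem2P => [x y|x]; apply: val_inj => /=;
  by [exact: elab2C | exact: elab2_sqr].
Qed.
Definition elab2_subg (A : elab2) (K : {group A}) :=
  Elab2 (elab2_subg_subproof K).

Notation sgn_char A := {multiplicative A -> elabC}.
Definition sigma : sgn_char elabC := idfun.

Definition character_morphism (A : elab2) (l : sgn_char A) :
  {morphism [set: A] >-> elabC} := 
  @Morphism _ _ [set: A] l (in2W (@gmulfM _ _ l)).
Definition elab2_ker (A : elab2) (l : sgn_char A) : elab2 :=
  elab2_subg ('ker (character_morphism l))%G.
Definition ker_incl (A : elab2) (l : sgn_char A) :
  {multiplicative elab2_ker l -> A} := @sgval _ _.
Lemma ker_inclP (A : elab2) (l : sgn_char A) (x : elab2_ker l) :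
  l (ker_incl l x) = 1%g.
Proof. by have := subgP x; rewrite inE => /andP[_]; rewrite !inE => /eqP. Qed.

Section RO.
Variable R : realType.

Definition sign (c : elabC) : R := (-1) ^+ (c : 'Z_2).

Lemma signM (c d : elabC) : sign (c * d)%g = sign c * sign d.
Proof.
by rewrite /sign -exprD -[RHS]signr_odd -modn2.
Qed.

Lemma sign1 : sign 1%g = 1. Proof. by []. Qed.

(* Elements of $I_A \subseteq RO(A)$.  The real representation ring is taken
   to be the ring of virtual characters: a virtual representation is recorded
   by its trace function, which determines it since R has characteristic 0. *)
Record IRO (A : elab2) := IROmk {
  IROval :> A -> R;
  IROvalP : exists (k : int) (V : representation R [set: A]),
    forall g, IROval g = k%:~R - \tr (V g)
}.

Lemma IRO_eq (A : elab2) (m n : IRO A) : m =1 n -> m = n.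
Proof.
case: m n => [m mP] [n nP] /= /funext mn; rewrite mn in mP *.
by rewrite (Prop_irrelevance mP nP).
Qed.

Lemma IROint_subproof (A : elab2) (k : int) :
  exists (k' : int) (V : representation R [set: A]),
    forall g : A, k%:~R = k'%:~R - \tr (V g).
Proof.
by exists k, (@grepr0 R A [set: A]) => g; rewrite /mxtrace big_ord0 subr0.
Qed.
Definition IROint (A : elab2) (k : int) : IRO A :=
  IROmk (IROint_subproof A k).

Lemma IROadd_subproof (A : elab2) (m n : IRO A) :
  exists (k : int) (V : representation R [set: A]),
    forall g : A, m g + n g = k%:~R - \tr (V g).
Proof.
have [k1 [V1 e1]] := IROvalP m; have [k2 [V2 e2]] := IROvalP n.
exists (k1 + k2), (dadd_grepr V1 V2) => g.
by rewrite e1 e2 mxtrace_block intrD opprD addrACA.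
Qed.
Definition IROadd (A : elab2) (m n : IRO A) : IRO A :=
  IROmk (IROadd_subproof m n).

Lemma character_repr_subproof (A : elab2) (l : sgn_char A) :
  mx_repr [set: A] (fun g : A => (sign (l g))%:M : 'M[R]_1).
Proof.
split=> [|x y _ _]; last by rewrite gmulfM signM scalar_mxM.
by rewrite gmulf_one sign1.
Qed.
Definition character_repr (A : elab2) (l : sgn_char A) :
    representation R [set: A] :=
  Representation (MxRepresentation (character_repr_subproof l)).

Lemma IROsub_subproof (A : elab2) (m : IRO A) (l : sgn_char A) :
  exists (k : int) (V : representation R [set: A]),
    forall g : A, m g - sign (l g) = k%:~R - \tr (V g).
Proof.
have [k [V e]] := IROvalP m; exists k, (dadd_grepr V (character_repr l)) => g.
by rewrite e mxtrace_block mxtrace_scalar mulr1n opprD addrA.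
Qed.
Definition IROsub (A : elab2) (m : IRO A) (l : sgn_char A) : IRO A :=
  IROmk (IROsub_subproof m l).

Lemma IROpull_subproof (A B : elab2) (f : {multiplicative B -> A}) (m : IRO A) :
  exists (k : int) (V : representation R [set: B]),
    forall g : B, m (f g) = k%:~R - \tr (V g).
Proof.
have [k [V e]] := IROvalP m.
have fV : mx_repr [set: B] (fun g => V (f g)).
  split=> [|x y _ _]; last by rewrite gmulfM repr_mxM ?inE.
  by rewrite gmulf_one repr_mx1.
by exists k, (Representation (MxRepresentation fV)) => g; rewrite e.
Qed.
Definition IROpull (A B : elab2) (f : {multiplicative B -> A}) (m : IRO A) :
  IRO B := IROmk (IROpull_subproof f m).

Record el2RO := El2RO { ob_group : elab2; ob_degree : IRO ob_group }.

Record hom (P Q : el2RO) := Hom {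
  hom_fun :> {multiplicative ob_group P -> ob_group Q};
  hom_degree : IROpull hom_fun (ob_degree Q) =1 ob_degree P
}.

Lemma hom_ext (P Q : el2RO) (f g : hom P Q) : f =1 g -> f = g.
Proof.
case: f g => [f fd] [g gd] /= /gmulf_ext fg; rewrite fg in fd *.
by rewrite (Prop_irrelevance fd gd).
Qed.

Definition hom_id (P : el2RO) : hom P P :=
  @Hom P P idfun (fun=> erefl).

Lemma hom_comp_subproof (P Q S : el2RO) (g : hom Q S) (f : hom P Q) :
  IROpull (g \o f) (ob_degree S) =1 ob_degree P.
Proof. by move=> x; rewrite -(hom_degree f) /= -(hom_degree g). Qed.
Definition hom_comp (P Q S : el2RO) (g : hom Q S) (f : hom P Q) : hom P S :=
  Hom (hom_comp_subproof g f).

Definition tens (P Q : el2RO) : el2RO :=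
  @El2RO (elab2_prod (ob_group P) (ob_group Q))
    (IROadd (@IROpull _ (elab2_prod _ _) fst (ob_degree P))
            (@IROpull _ (elab2_prod _ _) snd (ob_degree Q))).

Definition tens1 : el2RO := El2RO (IROint elab1 0).

Section Homs.
Variables P Q S P' Q' : el2RO.

Definition hom_tens_fun (f : hom P P') (g : hom Q Q') :
  ob_group (tens P Q) -> ob_group (tens P' Q') := fun x => (f x.1, g x.2).
Lemma hom_tens_funM f g : {morph hom_tens_fun f g : x y / (x * y)%g}.
Proof. by move=> x y; congr pair; exact: gmulfM. Qed.
HB.instance Definition _ f g :=
  isMultiplicative.Build _ _ (hom_tens_fun f g) (hom_tens_funM f g).
Lemma hom_tens_subproof f g :
  IROpull (hom_tens_fun f g) (ob_degree (tens P' Q')) =1 ob_degree (tens P Q).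
Proof. by move=> x /=; rewrite -(hom_degree f) -(hom_degree g). Qed.
Definition hom_tens f g : hom (tens P Q) (tens P' Q') :=
  Hom (hom_tens_subproof f g).

Definition hom_assoc_fun :
  ob_group (tens (tens P Q) S) -> ob_group (tens P (tens Q S)) :=
  fun x => (x.1.1, (x.1.2, x.2)).
Lemma hom_assoc_funM : {morph hom_assoc_fun : x y / (x * y)%g}.
Proof. by []. Qed.
HB.instance Definition _ :=
  isMultiplicative.Build _ _ hom_assoc_fun hom_assoc_funM.
Lemma hom_assoc_subproof :
  IROpull hom_assoc_fun (ob_degree (tens P (tens Q S))) =1
  ob_degree (tens (tens P Q) S).
Proof. by move=> x /=; rewrite addrA. Qed.
Definition hom_assoc : hom (tens (tens P Q) S) (tens P (tens Q S)) :=
  Hom hom_assoc_subproof.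

Definition hom_swap_fun : ob_group (tens P Q) -> ob_group (tens Q P) :=
  fun x => (x.2, x.1).
Lemma hom_swap_funM : {morph hom_swap_fun : x y / (x * y)%g}.
Proof. by []. Qed.
HB.instance Definition _ :=
  isMultiplicative.Build _ _ hom_swap_fun hom_swap_funM.
Lemma hom_swap_subproof :
  IROpull hom_swap_fun (ob_degree (tens Q P)) =1 ob_degree (tens P Q).
Proof. by move=> x /=; rewrite addrC. Qed.
Definition hom_swap : hom (tens P Q) (tens Q P) := Hom hom_swap_subproof.

Lemma hom_lunit_subproof :
  @IROpull _ (elab2_prod elab1 (ob_group P)) snd (ob_degree P) =1 ob_degree (tens tens1 P).
Proof. by move=> x /=; rewrite add0r. Qed.
Definition hom_lunit : hom (tens tens1 P) P :=
  @Hom (tens tens1 P) P snd hom_lunit_subproof.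

Lemma hom_runit_subproof :
  @IROpull _ (elab2_prod (ob_group P) elab1) fst (ob_degree P) =1 ob_degree (tens P tens1).
Proof. by move=> x /=; rewrite addr0. Qed.
Definition hom_runit : hom (tens P tens1) P :=
  @Hom (tens P tens1) P fst hom_runit_subproof.
End Homs.

(* A lax symmetric monoidal functor to F_2-vector spaces; the monoidal pairing
   is given by bilinear maps and the unit map F_2 -> X(1,0) by the image of 1. *)
Record el2RO_algebra := El2ROAlgebra {
  Xob :> el2RO -> lmodType 'F_2;
  Xmap : forall P Q : el2RO, hom P Q -> {linear Xob Q -> Xob P};
  Xmap_id : forall (P : el2RO) (x : Xob P), Xmap (hom_id P) x = x;
  Xmap_comp : forall (P Q S : el2RO) (g : hom Q S) (f : hom P Q) (x : Xob S),
    Xmap (hom_comp g f) x = Xmap f (Xmap g x);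
  Xpair : forall P Q : el2RO, Xob P -> Xob Q -> Xob (tens P Q);
  Xpair_linearl : forall (P Q : el2RO) (y : Xob Q), linear (@Xpair P Q ^~ y);
  Xpair_linearr : forall (P Q : el2RO) (x : Xob P), linear (@Xpair P Q x);
  Xunit : Xob tens1;
  Xpair_natural : forall (P P' Q Q' : el2RO) (f : hom P P') (g : hom Q Q')
      (x : Xob P') (y : Xob Q'),
    Xpair (Xmap f x) (Xmap g y) = Xmap (hom_tens f g) (Xpair x y);
  Xpair_assoc : forall (P Q S : el2RO) (x : Xob P) (y : Xob Q) (z : Xob S),
    Xmap (hom_assoc P Q S) (Xpair x (Xpair y z)) = Xpair (Xpair x y) z;
  Xpair_lunit : forall (P : el2RO) (x : Xob P),
    Xpair Xunit x = Xmap (hom_lunit P) x;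
  Xpair_runit : forall (P : el2RO) (x : Xob P),
    Xpair x Xunit = Xmap (hom_runit P) x;
  Xpair_sym : forall (P Q : el2RO) (x : Xob P) (y : Xob Q),
    Xmap (hom_swap P Q) (Xpair y x) = Xpair x y
}.
Arguments Xmap {X P Q} : rename.
Arguments Xpair {X P Q} : rename.

Section Algebra.
Variable X : el2RO_algebra.
Local Notation "X_[ m ]" := (X (El2RO m)) (at level 8, format "X_[ m ]").

Section Product.
Variable A : elab2.
Implicit Types l m n : IRO A.

Definition diag (x : A) : elab2_prod A A := (x, x).
Lemma diagM : {morph diag : x y / (x * y)%g}. Proof. by []. Qed.
HB.instance Definition _ := isMultiplicative.Build A (elab2_prod A A) diag diagM.

Definition hom_diag l m n (e : IROadd m n =1 l) :
  hom (El2RO l) (tens (El2RO m) (El2RO n)) :=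
  @Hom (El2RO l) (tens (El2RO m) (El2RO n)) diag e.

(* The internal product X(A,m) x X(A,n) -> X(A,m+n).  The target degree is any
   l with a proof of m + n = l, which avoids casts between propositionally
   equal degrees. *)
Definition Xmul l m n (e : IROadd m n =1 l) (x : X_[m]) (y : X_[n]) : X_[l] :=
  Xmap (hom_diag e) (Xpair x y).

Lemma Xmap_ext (P Q : el2RO) (f g : hom P Q) (x : X Q) :
  f =1 g -> Xmap f x = Xmap g x.
Proof. by move=> /hom_ext ->. Qed.

Lemma Xmul_linearl l m n (e : IROadd m n =1 l) y : linear (Xmul e ^~ y).
Proof. by move=> c x x'; rewrite /Xmul Xpair_linearl linearP. Qed.
Lemma Xmul_linearr l m n (e : IROadd m n =1 l) x : linear (Xmul e x).
Proof. by move=> c y y'; rewrite /Xmul Xpair_linearr linearP. Qed.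

Lemma XmulDl l m n (e : IROadd m n =1 l) x x' y :
  Xmul e (x + x') y = Xmul e x y + Xmul e x' y.
Proof. by have := Xmul_linearl e y 1 x x'; rewrite !scale1r. Qed.
Lemma XmulDr l m n (e : IROadd m n =1 l) x y y' :
  Xmul e x (y + y') = Xmul e x y + Xmul e x y'.
Proof. by have := Xmul_linearr e x 1 y y'; rewrite !scale1r. Qed.

Lemma Xmulr0 l m n (e : IROadd m n =1 l) x : Xmul e x 0 = 0.
Proof.
by have /(congr1 (+%R^~ (- Xmul e x 0))) := XmulDr e x 0 0;
   rewrite addr0 subrr addrK.
Qed.
Lemma XmulrN l m n (e : IROadd m n =1 l) x y : Xmul e x (- y) = - Xmul e x y.
Proof.
by apply/eqP; rewrite -addr_eq0 -XmulDr addNr Xmulr0.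
Qed.

Lemma XmulC l m n (e : IROadd m n =1 l) (e' : IROadd n m =1 l) x y :
  Xmul e x y = Xmul e' y x.
Proof. by rewrite /Xmul -Xpair_sym -Xmap_comp; apply: Xmap_ext. Qed.

Lemma XmulA (i j k ij jk l : IRO A) (e1 : IROadd i j =1 ij) (e2 : IROadd ij k =1 l)
    (e3 : IROadd j k =1 jk) (e4 : IROadd i jk =1 l) x y z :
  Xmul e2 (Xmul e1 x y) z = Xmul e4 x (Xmul e3 y z).
Proof.
rewrite /Xmul -{1}[z]Xmap_id -{2}[x]Xmap_id !Xpair_natural -!Xmap_comp.
by rewrite -Xpair_assoc -!Xmap_comp; apply: Xmap_ext.
Qed.
End Product.

Definition hom_int (A B : elab2) (f : {multiplicative B -> A}) (k : int) :
    hom (El2RO (IROint B k)) (El2RO (IROint A k)) :=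
  @Hom (El2RO (IROint B k)) (El2RO (IROint A k)) f (fun=> erefl).

Definition Xone (A : elab2) : X_[IROint A 0] :=
  Xmap (hom_int (one_fun elab1 : {multiplicative A -> elab1}) 0) (Xunit X).

Lemma Xmul1 (A : elab2) (m n : IRO A) (e : IROadd (IROint A 0) m =1 n)
    (d : hom (El2RO n) (El2RO m)) (x : X_[m]) :
  d =1 id -> Xmul e (Xone A) x = Xmap d x.
Proof.
move=> dE; rewrite /Xmul -{1}[x]Xmap_id Xpair_natural Xpair_lunit -!Xmap_comp.
by apply: Xmap_ext => z; rewrite dE.
Qed.

Lemma Xmap_mul (A B : elab2) (l m n : IRO A) (l' m' n' : IRO B)
    (e : IROadd m n =1 l) (e' : IROadd m' n' =1 l')
    (f : hom (El2RO l') (El2RO l)) (g : hom (El2RO m') (El2RO m))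
    (h : hom (El2RO n') (El2RO n)) x y :
  f =1 g -> f =1 h -> Xmap f (Xmul e x y) = Xmul e' (Xmap g x) (Xmap h y).
Proof.
move=> fg fh; rewrite /Xmul Xpair_natural -!Xmap_comp.
apply: Xmap_ext => z; exact: (congr2 pair (fg z) (fh z)).
Qed.

Lemma IROint_add (A : elab2) (i j k : int) : i + j = k ->
  IROadd (IROint A i) (IROint A j) =1 IROint A k.
Proof. by move=> <- x /=; rewrite intrD. Qed.

Lemma XgrA (A : elab2) i j k ij jk l (e1 : i + j = ij) (e2 : ij + k = l)
    (e3 : j + k = jk) (e4 : i + jk = l)
    (x : X_[IROint A i]) (y : X_[IROint A j]) (z : X_[IROint A k]) :
  Xmul (IROint_add e2) (Xmul (IROint_add e1) x y) z =
  Xmul (IROint_add e4) x (Xmul (IROint_add e3) y z).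
Proof. exact: XmulA. Qed.

Lemma Xgr1 (A : elab2) i (e : 0 + i = i) (x : X_[IROint A i]) :
  Xmul (IROint_add e) (Xone A) x = x.
Proof.
have := Xmul1 (IROint_add e) (d := hom_id (El2RO (IROint A i))) x (fun=> erefl).
by rewrite Xmap_id.
Qed.

(* X(A)_* *)
Definition Xgr (A : elab2) : graded_ring :=
  @GradedRing (fun k => X_[IROint A k]) (fun i j k e => Xmul (IROint_add e))
    (Xone A) (fun i j k e => XmulDl (IROint_add e))
    (fun i j k e e' => XmulC (IROint_add e) (IROint_add e'))
    (@XgrA A) (@Xgr1 A).

Lemma hom_int_one (A B : elab2) (f : {multiplicative B -> A}) :
  Xmap (hom_int f 0) (Xone A) = Xone B.
Proof. by rewrite /Xone -Xmap_comp; apply: Xmap_ext. Qed.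

Lemma hom_int_mul (A B : elab2) (f : {multiplicative B -> A}) i j k
    (e : i + j = k) (x : X_[IROint A i]) (y : X_[IROint A j]) :
  Xmap (hom_int f k) (Xmul (IROint_add e) x y) =
  Xmul (IROint_add e) (Xmap (hom_int f i) x) (Xmap (hom_int f j) y).
Proof. exact: Xmap_mul. Qed.

Definition Xgr_map (A B : elab2) (f : {multiplicative B -> A}) :
    graded_hom (Xgr A) (Xgr B) :=
  @GradedHom (Xgr A) (Xgr B) (fun k => Xmap (hom_int f k))
    (hom_int_one f) (hom_int_mul f).

Definition inflation (A : elab2) : graded_hom (Xgr elab1) (Xgr A) :=
  Xgr_map (one_fun elab1).

Lemma hom_character_subproof (A : elab2) (l : sgn_char A) :
  IROpull l (IROsub (IROint elabC 0) sigma) =1 IROsub (IROint A 0) l.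
Proof. by []. Qed.
Definition hom_character (A : elab2) (l : sgn_char A) :
    hom (El2RO (IROsub (IROint A 0) l))
        (El2RO (IROsub (IROint elabC 0) sigma)) :=
  @Hom (El2RO (IROsub (IROint A 0) l))
    (El2RO (IROsub (IROint elabC 0) sigma)) l (@hom_character_subproof A l).

Lemma IROsub_add (A : elab2) (l : sgn_char A) (m : IRO A) :
  IROadd (IROsub (IROint A 0) l) m =1 IROsub m l.
Proof. by move=> x /=; rewrite sub0r addrC. Qed.

Lemma hom_ker_subproof (A : elab2) (l : sgn_char A) (m : IRO A) :
  IROpull (ker_incl l) (IROsub m l) =1
  IROadd (IROpull (ker_incl l) m) (IROint (elab2_ker l) (-1)).
Proof.
move=> x; change (m (ker_incl l x) - sign (l (ker_incl l x)) =
  m (ker_incl l x) + (-1)%:~R).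
by rewrite ker_inclP sign1.
Qed.
Definition hom_ker (A : elab2) (l : sgn_char A) (m : IRO A) :
    hom (El2RO (IROadd (IROpull (ker_incl l) m) (IROint (elab2_ker l) (-1))))
        (El2RO (IROsub m l)) :=
  @Hom (El2RO (IROadd (IROpull (ker_incl l) m) (IROint (elab2_ker l) (-1))))
    (El2RO (IROsub m l)) (ker_incl l) (@hom_ker_subproof A l m).

Section Oriented.
Variable a : X_[IROsub (IROint elabC 0) sigma].
Variable t : X_[IROsub (IROint elabC 1) sigma].

Definition mul_a (A : elab2) (l : sgn_char A) (m : IRO A) (x : X_[m]) :
    X_[IROsub m l] :=
  Xmul (IROsub_add l m) (Xmap (hom_character l) a) x.
Arguments mul_a {A} l {m}.

Definition orientable : Prop :=
  forall (A : elab2) (m : IRO A) (l : sgn_char A),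
  (exists g : A, l g != 1%g) ->
  [/\ injective (@mul_a A l m),
      forall x : X_[IROsub m l],
        Xmap (hom_ker l m) x = 0 <-> exists y : X_[m], mul_a l y = x
    & forall z : X_[IROadd (IROpull (ker_incl l) m) (IROint (elab2_ker l) (-1))],
        exists x : X_[IROsub m l], Xmap (hom_ker l m) x = z].

Lemma hom_thom_subproof :
  IROpull (one_fun elabC : {multiplicative elab1 -> elabC})
    (IROsub (IROint elabC 1) sigma) =1 IROint elab1 0.
Proof. by move=> x /=; rewrite sign1 subrr. Qed.
Definition hom_thom : hom tens1 (El2RO (IROsub (IROint elabC 1) sigma)) :=
  @Hom tens1 (El2RO (IROsub (IROint elabC 1) sigma))
    (one_fun elabC) hom_thom_subproof.

Definition inverse_thom_class : Prop := Xmap hom_thom t = Xunit X.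

Definition oriented : Prop := orientable /\ inverse_thom_class.

Lemma IROsub_add1 (k : int) :
  IROadd (IROsub (IROint elabC 1) sigma) (IROint elabC k) =1
  IROsub (IROint elabC (k + 1)) sigma.
Proof. by move=> x /=; rewrite addrAC -intrD [1 + k]addrC. Qed.

Definition mul_t (k : int) (x : Xgr elabC k) :
    X_[IROsub (IROint elabC (k + 1)) sigma] :=
  Xmul (IROsub_add1 k) t x.

Definition eps : {multiplicative elabC -> elabC} := one_fun elabC.

(* a * w = t * (x + eps^* x) *)
Definition is_Gamma (k : int) (x : Xgr elabC k) (w : Xgr elabC (k + 1)) : Prop :=
  mul_a sigma w = mul_t (x + Xgr_map eps k x).

Definition Gamma (k : int) (x : Xgr elabC k) : Xgr elabC (k + 1) :=
  xget 0 [set w | is_Gamma x w].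

Lemma Gamma_exists (k : int) (x : Xgr elabC k) :
  orientable -> exists! w, is_Gamma x w.
Proof.
move=> /(_ _ (IROint elabC (k + 1)) sigma) [|inj ker _].
  by exists (1%R : 'Z_2).
have [|w we] := (ker (mul_t (x + Xgr_map eps k x))).1; last first.
  by exists w; split=> // w'; rewrite -/(is_Gamma _ _) => /esym; rewrite -we => /inj.
pose K := elab2_ker sigma.
have tK1 : IROpull (ker_incl sigma) (IROsub (IROint elabC 1) sigma) =1 IROint K 0.
  move=> z; rewrite [LHS](@hom_ker_subproof _ sigma (IROint elabC 1) z) /=.
  by rewrite -intrD.
have e : IROadd (IROint K 0) (IROint K k) =1
    IROadd (IROpull (ker_incl sigma) (IROint elabC (k + 1))) (IROint K (-1)).
  by move=> z /=; rewrite -!intrD addrK add0r.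
rewrite (Xmap_mul _ e (g := @Hom (El2RO (IROint K 0)) (El2RO (IROsub (IROint elabC 1) sigma)) _ tK1)
  (h := hom_int (ker_incl sigma) k)) //.
set z := Xmap _ (_ + _); suff -> : z = 0.
  exact: Xmulr0.
rewrite /z linearD /= -Xmap_comp.
rewrite [X in _ + X](Xmap_ext _ (g := hom_int (ker_incl sigma) k)).
  by rewrite -[Xmap _ x]scale1r -scalerDl (_ : 1 + 1 = 0) ?scale0r //; exact: val_inj.
by move=> u; have /= -> := ker_inclP u.
Qed.

Lemma GammaP (k : int) (x : Xgr elabC k) :
  orientable -> is_Gamma x (Gamma x).
Proof. by move=> /(Gamma_exists x) [w [wx _]]; exact: (xgetPex 0 (ex_intro _ w wx)). Qed.

Fixpoint iter_degree (n : nat) (k : int) : int :=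
  if n is n'.+1 then iter_degree n' k + 1 else k.
Fixpoint iter_Gamma (n : nat) (k : int) (x : Xgr elabC k) :
    Xgr elabC (iter_degree n k) :=
  if n is n'.+1 then Gamma (iter_Gamma n' x) else x.
End Oriented.

Section GeometricFixedPoints.
Variable a : X_[IROsub (IROint elabC 0) sigma].
Implicit Types (i j k : int) (n m p : nat).

(* the degree k - n sigma *)
Definition tw k n : IRO elabC :=
  iter n (fun d => IROsub d sigma) (IROint elabC k).

Lemma twE k n (c : elabC) : tw k n c = k%:~R - sign c *+ n.
Proof.
by elim: n => [|n /= ->]; rewrite /= ?subr0 // mulrSr opprD addrA.
Qed.

Lemma tw_add i j k n m p : i + j = k -> (n + m)%N = p ->
  IROadd (tw i n) (tw j m) =1 tw k p.
Proof.
by move=> <- <- c; rewrite [LHS]/= !twE intrD mulrnDr opprD addrACA.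
Qed.

Definition tmul i j k n m p (e : i + j = k) (e' : (n + m)%N = p)
    (x : X_[tw i n]) (y : X_[tw j m]) : X_[tw k p] :=
  Xmul (tw_add e e') x y.

Fixpoint apow n : X_[tw 0 n] :=
  if n is n'.+1 then mul_a a sigma (apow n') else Xone elabC.

(* multiplication by a^m *)
Definition apow_mul k m n p (e : (m + n)%N = p) (x : X_[tw k n]) : X_[tw k p] :=
  tmul (add0r k) e (apow m) x.

Lemma apowD m n p (e : (m + n)%N = p) :
  tmul (addr0 0) e (apow m) (apow n) = apow p.
Proof.
case: p / e; elim: m => [|m IH].
  rewrite /tmul (@Xmul1 _ _ _ _ (hom_id _)) ?Xmap_id //.
by rewrite /tmul /= /mul_a (XmulA _ _ (tw_add (addr0 0) erefl)
  (IROsub_add _ _)) -IH.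
Qed.

Lemma apow_mulD k m n p (e : (m + n)%N = p) (x y : X_[tw k n]) :
  apow_mul e (x + y) = apow_mul e x + apow_mul e y.
Proof. exact: XmulDr. Qed.

Lemma apow_mulN k m n p (e : (m + n)%N = p) (x : X_[tw k n]) :
  apow_mul e (- x) = - apow_mul e x.
Proof. exact: XmulrN. Qed.

Lemma apow_mul_irr k m m' n p (e : (m + n)%N = p) (e' : (m' + n)%N = p)
    (x : X_[tw k n]) : apow_mul e x = apow_mul e' x.
Proof.
have mm' : m = m' by apply/eqP; rewrite -(eqn_add2r n) e e'.
by case: m' / mm' e'  => e'; rewrite (eq_irrelevance e e').
Qed.

Lemma apow_mul0 k n (e : (0 + n)%N = n) (x : X_[tw k n]) : apow_mul e x = x.
Proof. by rewrite /apow_mul /tmul (@Xmul1 _ _ _ _ (hom_id _)) ?Xmap_id. Qed.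

Lemma apow_mul2_subproof m m' n p q : (m + n)%N = p -> (m' + p)%N = q ->
  (m' + m + n)%N = q.
Proof. by move=> <- <-; rewrite addnA. Qed.
Lemma apow_mul2 k m m' n p q (e : (m + n)%N = p) (e' : (m' + p)%N = q)
    (x : X_[tw k n]) :
  apow_mul e' (apow_mul e x) = apow_mul (apow_mul2_subproof e e') x.
Proof.
rewrite /apow_mul -(apowD erefl) /tmul; apply/esym; exact: XmulA.
Qed.

Lemma apow_mul_tmul_subproof m n m' n' p p' q r :
  (m + n)%N = p -> (m' + n')%N = p' -> (p + p')%N = q -> (n + n')%N = r ->
  (m + m' + r)%N = q.
Proof. by move=> <- <- <- <-; rewrite addnACA. Qed.
Lemma apow_mul_tmul i j k m n m' n' p p' q r (d : i + j = k)
    (e : (m + n)%N = p) (e' : (m' + n')%N = p')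
    (f : (p + p')%N = q) (g : (n + n')%N = r)
    (x : X_[tw i n]) (y : X_[tw j n']) :
  tmul d f (apow_mul e x) (apow_mul e' y) =
  apow_mul (apow_mul_tmul_subproof e e' f g) (tmul d g x y).
Proof.
rewrite /apow_mul -(apowD erefl) /tmul.
have e1 : (n + p')%N = (m' + r)%N by rewrite -e' -g addnCA.
have e2 : (m + (m' + r))%N = q by rewrite addnA (apow_mul_tmul_subproof e e' f g).
rewrite (XmulA _ _ (tw_add d e1) (tw_add (add0r k) e2)).
rewrite [RHS](XmulA _ _ (tw_add (add0r k) erefl) (tw_add (add0r k) e2)).
congr (Xmul _ _ _).
rewrite -(XmulA (tw_add (addr0 i) erefl) (tw_add d (etrans (esym (addnA _ _ _)) (etrans (congr1 (addn n) e') e1))) _ _).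
rewrite (XmulC _ (tw_add (add0r i) (addnC m' n))).
by rewrite (XmulA _ _ (tw_add d g) (tw_add (add0r k) erefl)).
Qed.

(* Fractions x/a^n with x in X(C,k - n sigma). *)
Definition fraction k := {n : nat & X_[tw k n]}.
Definition frac k n (x : X_[tw k n]) : fraction k := Tagged (fun n => X_[tw k n]) x.

(* x/a^n = y/a^m iff a^(l+m) x = a^(l+n) y for some l *)
Definition frac_eq k (f g : fraction k) : bool :=
  `[< exists l : nat,
      apow_mul (addnAC l (tag g) (tag f)) (tagged f) =
      apow_mul (erefl (l + tag f + tag g)%N) (tagged g) >].

Lemma frac_eqP k (f g : fraction k) :
  frac_eq f g <-> exists (i j p : nat) (e : (i + tag f)%N = p) (e' : (j + tag g)%N = p),
    apow_mul e (tagged f) = apow_mul e' (tagged g).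
Proof.
split=> [/asboolP[l lE]|[i [j [p [e [e' E]]]]]].
  by exists (l + tag g)%N, (l + tag f)%N, _, (addnAC _ _ _), erefl.
apply/asboolP; exists i.
have h : (tag g + p)%N = (i + tag f + tag g)%N by rewrite e addnC.
have := congr1 (apow_mul h) E; rewrite !apow_mul2 => E'.
by rewrite (apow_mul_irr _ (apow_mul2_subproof e h)) E'; exact: apow_mul_irr.
Qed.

Lemma frac_eq_refl k : reflexive (@frac_eq k).
Proof. by move=> f; apply/frac_eqP; exists 0%N, 0%N, _, erefl, erefl. Qed.

Lemma frac_eq_sym k : symmetric (@frac_eq k).
Proof.
by move=> f g; apply/idP/idP => /frac_eqP[i [j [p [e [e' E]]]]];
   apply/frac_eqP; exists j, i, p, e', e.
Qed.

Lemma frac_eq_trans k : transitive (@frac_eq k).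
Proof.
move=> g f h /frac_eqP[i [j [p [e [e' E]]]]] /frac_eqP[i' [j' [p' [f1 [f2 F]]]]].
apply/frac_eqP.
have h1 : (i' + p)%N = (i' + j + tag g)%N by rewrite -addnA e'.
have h2 : (j + p')%N = (i' + j + tag g)%N by rewrite -f1 addnCA addnA.
exists _, _, _, (apow_mul2_subproof e h1), (apow_mul2_subproof f2 h2).
rewrite -!apow_mul2 E -F !apow_mul2; exact: apow_mul_irr.
Qed.

Canonical frac_equiv k :=
  EquivRel (@frac_eq k) (@frac_eq_refl k) (@frac_eq_sym k) (@frac_eq_trans k).

Definition frac_add k (f g : fraction k) : fraction k :=
  frac (apow_mul (addnC (tag g) (tag f)) (tagged f) +
        apow_mul (erefl (tag f + tag g)%N) (tagged g)).
Definition frac_opp k (f : fraction k) : fraction k := frac (- tagged f).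
Definition frac_mul i j k (e : i + j = k) (f : fraction i) (g : fraction j) :
    fraction k :=
  frac (tmul e (erefl (tag f + tag g)%N) (tagged f) (tagged g)).

Definition Phi_car k := {eq_quot (@frac_eq k)}%qT.
HB.instance Definition _ k : EqQuotient _ (@frac_eq k) (Phi_car k) :=
  EqQuotient.on (Phi_car k).
HB.instance Definition _ k := Choice.on (Phi_car k).

Lemma pi_eq k (f g : fraction k) :
  (\pi_(Phi_car k) f = \pi_(Phi_car k) g)%qT <-> frac_eq f g.
Proof. by split=> [/eqmodP|/eqmodP]. Qed.

Lemma frac_addP k (f f' g g' : fraction k) :
  frac_eq f f' -> frac_eq g g' -> frac_eq (frac_add f g) (frac_add f' g').
Proof.
move=> /frac_eqP[i [i' [p [e [e' E]]]]] /frac_eqP[j [j' [q [d [d' D]]]]].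
apply/frac_eqP; rewrite /frac_add /=.
have h : ((i + j) + (tag f + tag g))%N = (p + q)%N by rewrite addnACA e d.
have h' : ((i' + j') + (tag f' + tag g'))%N = (p + q)%N by rewrite addnACA e' d'.
exists (i + j)%N, (i' + j')%N, (p + q)%N, h, h'.
rewrite !apow_mulD !apow_mul2; congr (_ + _).
  have := congr1 (apow_mul (addnC q p)) E; rewrite !apow_mul2 => E'.
  rewrite (apow_mul_irr _ (apow_mul2_subproof e (addnC q p))) E'.
  exact: apow_mul_irr.
have := congr1 (apow_mul (erefl (p + q)%N)) D; rewrite !apow_mul2 => D'.
rewrite (apow_mul_irr _ (apow_mul2_subproof d erefl)) D'.
exact: apow_mul_irr.
Qed.

Lemma frac_oppP k (f f' : fraction k) :
  frac_eq f f' -> frac_eq (frac_opp f) (frac_opp f').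
Proof.
move=> /frac_eqP[i [i' [p [e [e' E]]]]]; apply/frac_eqP.
by exists i, i', p, e, e'; rewrite !apow_mulN E.
Qed.

Lemma frac_mulP i j k (e : i + j = k) (f f' : fraction i) (g g' : fraction j) :
  frac_eq f f' -> frac_eq g g' -> frac_eq (frac_mul e f g) (frac_mul e f' g').
Proof.
move=> /frac_eqP[n [n' [p [h [h' E]]]]] /frac_eqP[m [m' [q [d [d' D]]]]].
apply/frac_eqP.
exists _, _, _, (apow_mul_tmul_subproof h d erefl erefl),
  (apow_mul_tmul_subproof h' d' erefl erefl).
by rewrite -!apow_mul_tmul E D.
Qed.

Local Notation "\pi f" := (\pi_(Phi_car _) f)%qT (at level 10, f at level 8).

Lemma Phi_ind k (P : Phi_car k -> Prop) :
  (forall f : fraction k, P (\pi f)) -> forall x, P x.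
Proof. by move=> Pf; elim/quotW. Qed.

Lemma frac_eq_repr k (f : fraction k) : frac_eq (repr (\pi f)) f.
Proof. by apply/pi_eq; rewrite reprK. Qed.

Definition Phi_add k (x y : Phi_car k) : Phi_car k :=
  \pi (frac_add (repr x) (repr y)).
Definition Phi_opp k (x : Phi_car k) : Phi_car k := \pi (frac_opp (repr x)).
Definition Phi_zero k : Phi_car k := \pi (frac (0 : X_[tw k 0])).
Definition Phi_mul i j k (e : i + j = k) (x : Phi_car i) (y : Phi_car j) :
  Phi_car k := \pi (frac_mul e (repr x) (repr y)).
Definition Phi_one : Phi_car 0 := \pi (frac (Xone elabC : X_[tw 0 0])).

Lemma pi_add k (f g : fraction k) :
  Phi_add (\pi f) (\pi g) = \pi (frac_add f g).
Proof. by apply/pi_eq/frac_addP; exact: frac_eq_repr. Qed.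
Lemma pi_opp k (f : fraction k) : Phi_opp (\pi f) = \pi (frac_opp f).
Proof. by apply/pi_eq/frac_oppP; exact: frac_eq_repr. Qed.
Lemma pi_mul i j k (e : i + j = k) (f : fraction i) (g : fraction j) :
  Phi_mul e (\pi f) (\pi g) = \pi (frac_mul e f g).
Proof. by apply/pi_eq/frac_mulP; exact: frac_eq_repr. Qed.

Lemma pi_congr k n m (x : X_[tw k n]) (y : X_[tw k m]) (e : n = m) :
  apow_mul (e : (0 + n)%N = m) x = y -> \pi (frac x) = \pi (frac y).
Proof.
move=> E; apply/pi_eq/frac_eqP; exists 0%N, 0%N, _, e, erefl.
by rewrite /= E apow_mul0.
Qed.

Lemma Phi_addA k : associative (@Phi_add k).
Proof.
elim/Phi_ind=> f; elim/Phi_ind=> g; elim/Phi_ind=> h; rewrite !pi_add.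
rewrite /frac_add; apply: (pi_congr (e := addnA _ _ _)) => /=.
rewrite !apow_mulD !apow_mul2 addrA.
by congr (_ + _ + _); exact: apow_mul_irr.
Qed.

Lemma Phi_addC k : commutative (@Phi_add k).
Proof.
elim/Phi_ind=> f; elim/Phi_ind=> g; rewrite !pi_add.
rewrite /frac_add; apply: (pi_congr (e := addnC _ _)) => /=.
rewrite !apow_mulD !apow_mul2 addrC.
by congr (_ + _); exact: apow_mul_irr.
Qed.

Lemma apow_mulr0 k n m p (e : (m + n)%N = p) :
  apow_mul e (0 : X_[tw k n]) = 0.
Proof. exact: Xmulr0. Qed.

Lemma Phi_add0 k : left_id (Phi_zero k) (@Phi_add k).
Proof.
elim/Phi_ind=> -[n x]; rewrite pi_add.
apply: (pi_congr (e := erefl n)) => /=.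
by rewrite apow_mulr0 add0r apow_mul2 -[RHS](apow_mul0 erefl); exact: apow_mul_irr.
Qed.

Lemma Phi_addN k : left_inverse (Phi_zero k) (@Phi_opp k) (@Phi_add k).
Proof.
elim/Phi_ind=> f; rewrite pi_opp pi_add; apply/pi_eq/frac_eqP.
exists 0%N, (tag f + tag f)%N, _, erefl, (addn0 _).
rewrite apow_mul0 /= apow_mulr0 apow_mulN.
by rewrite (apow_mul_irr _ (erefl (tag f + tag f)%N)) addNr.
Qed.

HB.instance Definition _ k := GRing.isZmodule.Build (Phi_car k)
  (@Phi_addA k) (@Phi_addC k) (@Phi_add0 k) (@Phi_addN k).

Lemma Phi_mulDl i j k (e : i + j = k) (x x' : Phi_car i) (y : Phi_car j) :
  Phi_mul e (x + x') y = Phi_mul e x y + Phi_mul e x' y.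
Proof.
move: x x' y; elim/Phi_ind=> f; elim/Phi_ind=> f'; elim/Phi_ind=> g.
rewrite -[X in Phi_mul _ X _]/(Phi_add _ _) -[RHS]/(Phi_add _ _).
rewrite pi_add !pi_mul pi_add; apply/pi_eq/frac_eqP.
have h : (tag g + (tag f + tag f' + tag g))%N
    = (tag f + tag g + (tag f' + tag g))%N.
  by rewrite addnC addnACA addnA.
exists (tag g), 0%N, _, h, erefl; rewrite apow_mul0 /=.
have tmulDl n m p (d : (n + m)%N = p) (u v : X_[tw i n]) (w : X_[tw j m]) :
  tmul e d (u + v) w = tmul e d u w + tmul e d v w by exact: XmulDl.
rewrite tmulDl -{1 2}[tagged g](apow_mul0 erefl) !(apow_mul_tmul _ _ _ _ erefl).
rewrite apow_mulD !apow_mul2.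
by congr (_ + _); exact: apow_mul_irr.
Qed.

Lemma apow_mul0E k n m (e : n = m) (x : X_[tw k n])
    (d : hom (El2RO (tw k m)) (El2RO (tw k n))) :
  d =1 id -> apow_mul (e : (0 + n)%N = m) x = Xmap d x.
Proof. exact: Xmul1. Qed.

Lemma hom_cast_subproof k n m (e : n = m) :
  IROpull idfun (tw k n) =1 tw k m.
Proof. by rewrite e. Qed.
Definition hom_cast k n m (e : n = m) :
    hom (El2RO (tw k m)) (El2RO (tw k n)) :=
  @Hom (El2RO (tw k m)) (El2RO (tw k n)) idfun (@hom_cast_subproof k n m e).

Lemma Phi_mulC i j k (e : i + j = k) (e' : j + i = k)
    (x : Phi_car i) (y : Phi_car j) : Phi_mul e x y = Phi_mul e' y x.
Proof.
move: x y; elim/Phi_ind=> f; elim/Phi_ind=> g; rewrite !pi_mul.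
rewrite /frac_mul; apply: (pi_congr (e := addnC _ _)).
rewrite (@apow_mul0E _ _ _ _ _ (hom_cast k (addnC (tag f) (tag g)))) //.
rewrite /tmul (Xmap_mul _ (tw_add e (addnC (tag f) (tag g))) (g := hom_id _) (h := hom_id _)) // !Xmap_id.
exact: XmulC.
Qed.

Lemma Phi_mulA i j k ij jk l (e1 : i + j = ij) (e2 : ij + k = l)
    (e3 : j + k = jk) (e4 : i + jk = l)
    (x : Phi_car i) (y : Phi_car j) (z : Phi_car k) :
  Phi_mul e2 (Phi_mul e1 x y) z = Phi_mul e4 x (Phi_mul e3 y z).
Proof.
move: x y z; elim/Phi_ind=> f; elim/Phi_ind=> g; elim/Phi_ind=> h.
rewrite !pi_mul /frac_mul; apply: (pi_congr (e := esym (addnA _ _ _))).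
rewrite (@apow_mul0E _ _ _ _ _ (hom_cast l (esym (addnA (tag f) (tag g) (tag h))))) //.
rewrite /tmul (Xmap_mul _ (tw_add e2 (esym (addnA (tag f) (tag g) (tag h)))) (g := hom_id _) (h := hom_id _)) // !Xmap_id.
exact: XmulA.
Qed.

Lemma Phi_mul1 i (e : 0 + i = i) (x : Phi_car i) : Phi_mul e Phi_one x = x.
Proof.
move: x; elim/Phi_ind=> -[n x]; rewrite pi_mul.
apply: (pi_congr (e := erefl n)); rewrite apow_mul0.
by rewrite /= /tmul (@Xmul1 _ _ _ _ (hom_id _)) ?Xmap_id.
Qed.

(* The integer graded part of the localization of X(C, -) at a. *)
Definition Phi : graded_ring :=
  @GradedRing Phi_car Phi_mul Phi_one Phi_mulDl Phi_mulC Phi_mulA Phi_mul1.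

Definition Phi_frac k n (x : X_[tw k n]) : Phi k := \pi (frac x).
Definition Phi_loc_fun k (x : Xgr elabC k) : Phi k := @Phi_frac k 0 x.

Lemma Phi_loc_additive k : zmod_morphism (@Phi_loc_fun k).
Proof.
move=> x y; rewrite -[RHS]/(Phi_add _ (Phi_opp _)) pi_opp pi_add.
by congr (\pi (frac _)); rewrite !apow_mul0.
Qed.
HB.instance Definition _ k := GRing.isZmodMorphism.Build (Xgr elabC k) (Phi k)
  (@Phi_loc_fun k) (@Phi_loc_additive k).

Lemma Phi_loc_mul i j k (e : i + j = k) (x : Xgr elabC i) (y : Xgr elabC j) :
  Phi_loc_fun (gr_mul e x y) = gr_mul e (Phi_loc_fun x) (Phi_loc_fun y).
Proof.
rewrite /= [RHS]pi_mul; congr (\pi (frac _)).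
by rewrite /= /tmul /Xmul; exact: Xmap_ext.
Qed.

Definition Phi_loc : graded_hom (Xgr elabC) Phi :=
  @GradedHom (Xgr elabC) Phi (fun k => @Phi_loc_fun k) erefl Phi_loc_mul.
End GeometricFixedPoints.

Definition graded_connected : Prop :=
  (forall (k : int) (x : Xgr elab1 k), k < 0 -> x = 0) /\
  bijective (fun c : 'F_2 => c *: Xunit X).

Section Generators.
Variable a : X_[IROsub (IROint elabC 0) sigma].
Variable t : X_[IROsub (IROint elabC 1) sigma].
Variables (I : choiceType) (d : I -> int) (y : forall i, Xgr elabC (d i)).

(* The classes y_i/1, indexed by [Some i], and t/a, indexed by [None]. *)
Definition generator_degree (o : option I) : int :=
  if o is Some i then d i else 1.
Definition generator (o : option I) : Phi a (generator_degree o) :=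
  match o with
  | Some i => Phi_loc a (d i) (y i)
  | None => @Phi_frac a 1 1 t
  end.

(* [None] indexes 1, and [Some (n, M)] indexes Gamma^n of the product of the
   y_i over the nonempty finite multiset M. *)
Definition basis_index : choiceType :=
  option (nat * {M : {mset I} | (0 < size (enum_mset M))%N}).
Definition basis_degree (b : basis_index) : int :=
  if b is Some (n, M) then iter_degree n (mdegree d (val M)) else 0.
Definition basis_class (b : basis_index) : Xgr elabC (basis_degree b) :=
  match b with
  | Some (n, M) => iter_Gamma a t n (monomial y (val M))
  | None => gr_one
  end.
End Generators.

End Algebra.
End RO.

(* Main.v *)
Require Import Defs.
From HB Require Import structures.
From mathcomp Require Import all_boot all_order all_algebra fingroup reals.
From mathcomp Require Import finmap multiset boolp classical_sets cardinality fsbigop.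
Set Implicit Arguments.
Unset Strict Implicit.
Unset Printing Implicit Defensive.
Import Order.TTheory GRing.Theory Num.Theory.
Local Open Scope mset_scope.
Local Open Scope ring_scope.

(* Write u = t/a and let eps be the trivial endomorphism of C.  In Phi the
   operator Gamma becomes x |-> u (x + eps^* x), so Gamma^n(y^M) equals u^n y^M
   modulo the X(1)_*-span of the u^j with j > 0.  As the u^n y^M form a basis of
   Phi, so do 1, the Gamma^n(y^M) with M nonempty and the u^j with j > 0.
   Finally X(C)_* embeds in Phi and meets the span of the positive powers of u
   in 0: if a polynomial of degree n > 0 in u without constant term comes from
   X(C)_*, then multiplying it by a^n and restricting to the trivial group,
   where a becomes 0 and t becomes 1, shows that its top coefficient is 0. *)

(** * Graded rings: homogeneous elements and transport between equal degrees *)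

Section GradedRing.
Variable T : graded_ring.
Implicit Types i j k : int.

Lemma gr_mulDr i j k (e : i + j = k) (x : T i) (y y' : T j) :
  gr_mul e x (y + y') = gr_mul e x y + gr_mul e x y'.
Proof.
have e' : j + i = k by rewrite addrC.
by rewrite !(gr_mulC e e') gr_mulDl.
Qed.

Lemma gr_mulr0 i j k (e : i + j = k) (x : T i) : gr_mul e x (0 : T j) = 0.
Proof. by apply: (addrI (gr_mul e x 0)); rewrite -gr_mulDr !addr0. Qed.

Lemma gr_mul0r i j k (e : i + j = k) (y : T j) : gr_mul e (0 : T i) y = 0.
Proof. by rewrite (gr_mulC e (etrans (addrC j i) e)) gr_mulr0. Qed.

Lemma gr_mulrN i j k (e : i + j = k) (x : T i) (y : T j) :
  gr_mul e x (- y) = - gr_mul e x y.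
Proof. by apply/eqP; rewrite -addr_eq0 -gr_mulDr addNr gr_mulr0. Qed.

Lemma gr_mulNr i j k (e : i + j = k) (x : T i) (y : T j) :
  gr_mul e (- x) y = - gr_mul e x y.
Proof. by apply/eqP; rewrite -addr_eq0 -gr_mulDl addNr gr_mul0r. Qed.

(* Homogeneous elements of unspecified degree: here the ring axioms become
   Leibniz equalities, with no degree casts. *)
Definition homogeneous := {k : int & T k}.
Definition homog k (x : T k) : homogeneous := Tagged (gr_car T) x.

(** Degrees have decidable equality, so [tagged_as] recovers the second component of a dependent
    pair. *)
Lemma homog_inj k : injective (@homog k).
Proof.
move=> x y /(congr1 (tagged_as (homog x))).
by rewrite /homog !tagged_asE.
Qed.

Definition homog_mul (u v : homogeneous) : homogeneous :=
  homog (gr_mul erefl (tagged u) (tagged v)).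

Lemma homogM i j k (e : i + j = k) (x : T i) (y : T j) :
  homog (gr_mul e x y) = homog_mul (homog x) (homog y).
Proof. by case: k / e. Qed.

Lemma homog_mulA : associative homog_mul.
Proof.
move=> [i x] [j y] [k z]; rewrite /homog_mul /=.
rewrite -(gr_mulA erefl (esym (addrA i j k)) erefl erefl).
by rewrite (homogM (esym _)).
Qed.

Lemma homog_mulC : commutative homog_mul.
Proof.
move=> [i x] [j y]; rewrite /homog_mul /=.
by rewrite (gr_mulC erefl (addrC j i)) (homogM (addrC j i)).
Qed.

Lemma homog_mul1 : left_id (homog gr_one) homog_mul.
Proof.
by move=> [i x]; rewrite -[existT _ i x]/(homog x) -(homogM (add0r i)) gr_mul1.
Qed.

HB.instance Definition _ :=
  Monoid.isComLaw.Build homogeneous (homog gr_one) homog_mul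
    homog_mulA homog_mulC homog_mul1.

Lemma homog_prod_seq (J : choiceType) (d : J -> int) (z : forall b, T (d b)) s :
  homog (prod_seq z s) = \big[homog_mul/homog gr_one]_(b <- s) homog (z b).
Proof.
by elim: s => [|b s IHs]; rewrite ?big_nil // big_cons -IHs homogM.
Qed.

(** The transport comes with its specification, so that it is only ever used through
    [homog_gcast]. *)
Lemma gcast_subproof i j (x : T i) : i = j -> {y : T j | homog y = homog x}.
Proof. by case: j /; exists x. Qed.
Definition gcast i j (e : i = j) (x : T i) : T j := sval (gcast_subproof x e).
Lemma homog_gcast i j (e : i = j) (x : T i) : homog (gcast e x) = homog x.
Proof. exact: (svalP (gcast_subproof x e)). Qed.

Lemma gcastD i j (e : i = j) (x y : T i) :
  gcast e (x + y) = gcast e x + gcast e y.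
Proof.
apply: homog_inj; case: j / e; rewrite homog_gcast.
by congr (homog (_ + _)); apply: homog_inj; rewrite homog_gcast.
Qed.

Lemma homog_degree i j (x : T i) (y : T j) : homog x = homog y -> i = j.
Proof. by move/(congr1 tag). Qed.

Lemma homog0 i j (x : T i) (y : T j) : homog x = homog y -> x = 0 -> y = 0.
Proof.
move=> xy; have ij := homog_degree xy; case: j / ij y xy => y.
by move=> /homog_inj ->.
Qed.
End GradedRing.

Lemma gh_homog (S T : graded_ring) (f : graded_hom S T) i j (x : S i) (y : S j) :
  homog x = homog y -> homog (f i x) = homog (f j y).
Proof.
move=> xy; have ij := homog_degree xy; case: j / ij y xy => y.
by move=> /homog_inj ->.
Qed.

Lemma gh_prod_seq (S T : graded_ring) (f : graded_hom S T) (J : choiceType)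
    (d : J -> int) (z : forall b, S (d b)) s :
  homog (f _ (prod_seq z s)) =
  \big[@homog_mul T/homog gr_one]_(b <- s) homog (f _ (z b)).
Proof.
elim: s => [|b s IHs]; first by rewrite big_nil gh_one.
by rewrite big_cons -IHs gh_mul homogM.
Qed.

(** * Graded spans, coordinate functions and bases *)

Lemma finsupp_familyP (B : choiceType) (V : B -> zmodType)
    (c c' : finsupp_family V) : (forall b, c b = c' b) -> c = c'.
Proof.
case: c c' => [c cf] [c' cf'] /= cc'.
have E : c = c' by exact: functional_extensionality_dep.
by case: c' / E cf' {cc'} => cf'; rewrite (Prop_irrelevance cf cf').
Qed.

Lemma finsupp_familyD_subproof (B : choiceType) (V : B -> zmodType)
    (c c' : finsupp_family V) : finite_set [set b | c b + c' b != 0].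
Proof.
have fin : finite_set ([set b | c b != 0] `|` [set b | c' b != 0])%classic.
  by rewrite finite_setU; split; exact: ff_finite.
apply: sub_finite_set fin => b /= cb; have [cb0|] := eqVneq (c b) 0; last by left.
by right; rewrite cb0 add0r in cb.
Qed.
Definition finsupp_familyD (B : choiceType) (V : B -> zmodType)
  (c c' : finsupp_family V) : finsupp_family V :=
  FinsuppFamily (finsupp_familyD_subproof c c').

Section Basis.
Variables (S T : graded_ring) (phi : graded_hom S T).
Variables (B : choiceType) (d : B -> int) (v : forall b, T (d b)).
Implicit Types i j k : int.

(** The inductive form allows elimination by cases on generators, without manipulating finite
    families; a coefficient may have any degree [i] with [i + d b = k]. *)
Inductive graded_span k : T k -> Prop :=
| graded_span0 : graded_span 0
| graded_spanD x y : graded_span x -> graded_span y -> graded_span (x + y)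
| graded_span_gen b i (e : i + d b = k) (s : S i) :
    graded_span (gr_mul e (phi i s) (v b)).

Lemma graded_span_homog b i k (s : S i) (x : T k) :
  homog x = homog_mul (homog (phi i s)) (homog (v b)) -> graded_span x.
Proof.
move=> xE; have e : i + d b = k := congr1 tag (esym xE).
suff -> : x = gr_mul e (phi i s) (v b) by exact: graded_span_gen.
by apply: homog_inj; rewrite homogM.
Qed.

Lemma graded_spanM i j k (e : i + j = k) (s : S i) (x : T j) :
  graded_span x -> graded_span (gr_mul e (phi i s) x).
Proof.
move=> xP; elim: xP e => [|x1 x2 _ IH1 _ IH2|b l e' s'] e.
- by rewrite gr_mulr0; exact: graded_span0.
- by rewrite gr_mulDr; exact: graded_spanD.
- apply: (@graded_span_homog b (i + l) _ (gr_mul erefl s s')).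
  by rewrite gh_mul !homogM homog_mulA.
Qed.

Lemma graded_spanN k (x : T k) : graded_span x -> graded_span (- x).
Proof.
elim=> [|x1 x2 _ IH1 _ IH2|b i e s].
- by rewrite oppr0; exact: graded_span0.
- by rewrite opprD; exact: graded_spanD.
- by rewrite -gr_mulNr -raddfN; exact: graded_span_gen.
Qed.

(** A coordinate function of the family [v]. Values are compared through [homog] since [i] and
    [k - d b] are equal only propositionally. *)
Definition coefficient_at k b (f : T k -> S (k - d b)) : Prop :=
  [/\ {morph f : x y / x + y},
      forall i (e : i + d b = k) (s : S i),
        homog (f (gr_mul e (phi i s) (v b))) = homog s
    & forall b' i (e : i + d b' = k) (s : S i), b' != b ->
        f (gr_mul e (phi i s) (v b')) = 0].

(** Any duplicate-free list covering the support will do, so that several families can be summed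
    over one common list. *)
Lemma lincombE k (c : finsupp_family (fun b => S (k - d b))) (r : seq B) :
  uniq r -> (forall b, b \notin r -> c b = 0) ->
  lincomb phi v c = \sum_(b <- r) gr_mul (subrK (d b) k) (phi _ (c b)) (v b).
Proof.
move=> r_uniq cr; rewrite /lincomb (fsbigE r) //.
  by apply: eq_bigl => b; rewrite in_setT.
by move=> b _ /cr ->; rewrite raddf0 gr_mul0r.
Qed.

Lemma finsupp_family_seq (V : B -> zmodType) (c : finsupp_family V) :
  exists2 r : seq B, uniq r & forall b, b \notin r -> c b = 0.
Proof.
have [r rE] := (finite_seqP _).1 (ff_finite c).
exists (undup r) => [|b]; first exact: undup_uniq.
rewrite mem_undup; apply: contraNeq => cb.
by have : [set b | c b != 0]%classic b by []; rewrite rE.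
Qed.

Lemma lincombD k (c c' : finsupp_family (fun b => S (k - d b))) :
  lincomb phi v (finsupp_familyD c c') = lincomb phi v c + lincomb phi v c'.
Proof.
have [r _ cr] := finsupp_family_seq c; have [r' _ cr'] := finsupp_family_seq c'.
have uP : uniq (undup (r ++ r')) := undup_uniq _.
have in_r b : b \notin undup (r ++ r') -> c b = 0.
  by rewrite mem_undup mem_cat negb_or => /andP[/cr].
have in_r' b : b \notin undup (r ++ r') -> c' b = 0.
  by rewrite mem_undup mem_cat negb_or => /andP[_ /cr'].
rewrite !(lincombE uP) //=; last by move=> b br; rewrite in_r ?in_r' ?addr0.
rewrite -big_split /=; apply: eq_bigr => b _.
by rewrite raddfD gr_mulDl.
Qed.

(** The match keeps the equality of indices, which the transport from degree [i] to degree
    [k - d b'] needs. *)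
Definition single_fun k b i (e : i + d b = k) (s : S i) b' : S (k - d b') :=
  match b =P b' with
  | ReflectT bb' =>
    gcast (etrans (esym (addrK (d b) i)) (congr2 (fun x y => x - d y) e bb')) s
  | ReflectF _ => 0
  end.

Lemma single_funE k b i (e : i + d b = k) (s : S i) :
  homog (single_fun e s b) = homog s.
Proof. by rewrite /single_fun; case: eqP => // bb; rewrite homog_gcast. Qed.

Lemma single_fun0 k b i (e : i + d b = k) (s : S i) b' :
  b' != b -> single_fun e s b' = 0.
Proof. rewrite /single_fun; case: eqP => // bb' /eqP[]; exact: esym. Qed.

Lemma single_subproof k b i (e : i + d b = k) (s : S i) :
  finite_set [set b' | single_fun e s b' != 0].
Proof.
apply: sub_finite_set (finite_set1 b) => b' /= nz.
by apply/eqP; apply: contraNT nz => /single_fun0 ->.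
Qed.
Definition single k b i (e : i + d b = k) (s : S i) :
  finsupp_family (fun b => S (k - d b)) := FinsuppFamily (single_subproof e s).

Lemma lincomb_single k b i (e : i + d b = k) (s : S i) :
  lincomb phi v (single e s) = gr_mul e (phi i s) (v b).
Proof.
rewrite (@lincombE _ _ [:: b]) ?big_seq1 //; last first.
  by move=> b'; rewrite inE; exact: single_fun0.
apply: homog_inj; rewrite !homogM; congr (homog_mul _ _).
exact: gh_homog (single_funE _ _).
Qed.

Lemma lincomb_exists k (x : T k) : graded_span x ->
  exists c : finsupp_family (fun b => S (k - d b)), lincomb phi v c = x.
Proof.
elim=> [|x1 x2 _ [c1 <-] _ [c2 <-]|b i e s].
- have fin0 : finite_set [set b : B | (0 : S (k - d b)) != 0].
    by apply: sub_finite_set (finite_set0 B) => b /=; rewrite eqxx.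
  by exists (FinsuppFamily fin0); rewrite (@lincombE _ _ [::]) ?big_nil.
- by exists (finsupp_familyD c1 c2); exact: lincombD.
- by exists (single e s); exact: lincomb_single.
Qed.

(** Coordinate functions encode linear independence: they read the coefficients off a combination.
    Conversely, uniqueness makes the chosen coefficients of an element additive in it. *)
Lemma graded_basisP :
  graded_basis phi v <->
  (forall k (x : T k), graded_span x) /\
  (forall k b, exists f : T k -> S (k - d b), coefficient_at f).
Proof.
split=> [basis|[spanT coefs] k x].
  split=> [k x|k b].
    have [c [<- _]] := basis k x.
    apply: (big_ind (@graded_span k)) => [||b _].
    - exact: graded_span0.
    - exact: graded_spanD.
    - exact: graded_span_gen.
  have exc x : exists c : finsupp_family (fun b => S (k - d b)), lincomb phi v c = x.
    by have [c [cx _]] := basis k x; exists c.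
  pose coefs x := sval (cid (exc x)).
  have coefsP x : lincomb phi v (coefs x) = x := svalP (cid (exc x)).
  have coefsE c : coefs (lincomb phi v c) = c.
    have [c' [_ c'E]] := basis k (lincomb phi v c).
    exact: etrans (esym (c'E _ (coefsP _))) (c'E _ erefl).
  exists (fun x => coefs x b); split=> [x y|i e s|b' i e s b'b].
  - suff -> : coefs (x + y) = finsupp_familyD (coefs x) (coefs y) by [].
    by rewrite -[RHS]coefsE lincombD !coefsP.
  - by rewrite -lincomb_single coefsE single_funE.
  - by rewrite -lincomb_single coefsE /= single_fun0 // eq_sym.
have [c cx] := lincomb_exists (spanT k x).
exists c; split=> // c' c'x; apply: finsupp_familyP => b.
have [f [fD fb fb']] := coefs k b.
have f0 : f 0 = 0 by apply: (addrI (f 0)); rewrite -fD !addr0.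
suff fE (c0 : finsupp_family (fun b => S (k - d b))) : f (lincomb phi v c0) = c0 b.
  by rewrite -!fE cx c'x.
have [r r_uniq cr] := finsupp_family_seq c0.
rewrite (lincombE r_uniq cr) (big_morph f fD f0).
have [br|br] := boolP (b \in r).
  rewrite (big_rem b br) /= big1_seq ?addr0 => [|b' /andP[_]].
    by apply: homog_inj; rewrite fb.
  by rewrite mem_rem_uniq // => /andP[/= b'b _]; rewrite fb'.
rewrite big1_seq ?cr // => b' /andP[_ b'r]; rewrite fb' //.
by apply: contraNneq br => <-.
Qed.
End Basis.

(** * Lifting a basis from the target of a map of graded rings *)

Section Lift.
Variables (S T F : graded_ring) (infl : graded_hom S T) (loc : graded_hom T F).
Let phi := graded_hom_comp loc infl.
Variables (B : choiceType) (d : B -> int) (v : forall b, F (d b)).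
Variables (J : choiceType) (dJ : J -> int) (z : forall j, F (dJ j)) (g : J -> B).
Variables (B0 : choiceType) (d0 : B0 -> int) (w : forall b, T (d0 b)) (h : B0 -> B).

(* If [F] is the direct sum of [span z] and [span (loc \o w)], and the image of
   [T] meets [span z] trivially, then [w] is a basis of [T]. *)
Lemma graded_basis_lift :
  graded_basis phi v ->
  injective h -> (forall j b, h b != g j) ->
  (forall b, (exists b0, b = h b0) \/ (exists j, b = g j)) ->
  (forall j, homog (z j) = homog (v (g j))) ->
  (forall k (x : T k), graded_span phi z (loc k x) -> x = 0) ->
  (forall b, exists2 p, graded_span phi z p &
     homog (loc _ (w b) - p) = homog (v (h b))) ->
  graded_basis infl w.
Proof.
move=> /graded_basisP[spanF coefs] h_inj hg hg_surj zE meet0 wE.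
apply/graded_basisP; split=> [k x|k b].
  (* Spanning: [loc k x] is approximated, modulo the span of [z], by the image of a combination [x']
     of the [w b]; then [meet0] applies to [x - x']. *)
  have [x' [x'P x'E]] : exists x', graded_span infl w x' /\
      graded_span phi z (loc k x - loc k x').
    elim: (spanF k (loc k x)) => [|u1 u2 _ [x1 [P1 E1]] _ [x2 [P2 E2]]|b i e s].
    - exists 0; split; first exact: graded_span0.
      by rewrite raddf0 subrr; exact: graded_span0.
    - exists (x1 + x2); split; first exact: graded_spanD.
      by rewrite raddfD opprD addrACA; exact: graded_spanD.
    case: (hg_surj b) => [[b0 bE]|[j bE]]; subst b; last first.
      exists 0; split; first exact: graded_span0.
      rewrite raddf0 subr0; apply: (@graded_span_homog _ _ _ _ _ _ j i _ s).
      by rewrite homogM zE.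
    have [p pP pE] := wE b0.
    have e0 : i + d0 b0 = k by rewrite (homog_degree pE).
    exists (gr_mul e0 (infl i s) (w b0)); split; first exact: graded_span_gen.
    (* With [v (h b0)] replaced by [loc _ (w b0) - p], the difference is a multiple of [p]. *)
    suff -> : gr_mul e (phi i s) (v (h b0)) =
        gr_mul e0 (phi i s) (loc _ (w b0) - p).
      rewrite gh_mul gr_mulDr addrAC subrr add0r gr_mulrN -gr_mulrN.
      by apply: graded_spanM; exact: graded_spanN.
    by apply: homog_inj; rewrite !homogM pE.
  suff -> : x = x' by [].
  by apply/eqP; rewrite -subr_eq0; apply/eqP/meet0; rewrite raddfB.
(* Independence: the coordinate at [w b] is [loc] followed by the coordinate at [v (h b)]. The
   latter kills the span of [z], hence all correction terms. *)
have [p _ pE] := wE b; have db := homog_degree pE.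
have [f [fD fb fb']] := coefs k (h b).
have f0 : f 0 = 0 by apply: (addrI (f 0)); rewrite -fD !addr0.
have fspan (u : F k) : graded_span phi z u -> f u = 0.
  elim=> [//|u1 u2 _ E1 _ E2|j i e s].
    by rewrite fD E1 E2 addr0.
  have e' : i + d (g j) = k by rewrite -(homog_degree (zE j)).
  rewrite -(fb' (g j) i e' s); last by rewrite eq_sym.
  by congr f; apply: homog_inj; rewrite !homogM zE.
have floc b0 i (e : i + d0 b0 = k) (e' : i + d (h b0) = k) s :
    f (loc k (gr_mul e (infl i s) (w b0))) = f (gr_mul e' (phi i s) (v (h b0))).
  have [q qP qE] := wE b0.
  have -> : gr_mul e' (phi i s) (v (h b0)) = gr_mul e (phi i s) (loc _ (w b0) - q).
    by apply: homog_inj; rewrite !homogM qE.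
  rewrite (gh_mul loc) gr_mulDr fD [f (gr_mul e _ (- q))]fspan ?addr0 //.
  by apply: graded_spanM; exact: graded_spanN.
exists (fun x => gcast (congr1 (fun i => k - i) (esym db)) (f (loc k x))).
split=> [x y|i e s|b' i e s b'b].
- by rewrite raddfD fD gcastD.
- have e' : i + d (h b) = k by rewrite -db.
  by rewrite homog_gcast (floc _ _ _ e') fb.
have [q _ /homog_degree db'] := wE b'.
have e' : i + d (h b') = k by rewrite -db'.
rewrite (floc _ _ _ e') fb'; last by rewrite (inj_eq h_inj).
by apply: (homog0 _ (x := 0)); rewrite ?homog_gcast.
Qed.
End Lift.

(** * Fractions over powers of [a] in an oriented algebra *)

Section Oriented.
Variables (R : realType) (X : el2RO_algebra R).
Local Notation "X_[ m ]" := (X (El2RO m)) (at level 8, format "X_[ m ]").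
Variable a : X_[IROsub (IROint R elabC 0) sigma].
Variable t : X_[IROsub (IROint R elabC 1) sigma].
Hypothesis X_oriented : oriented a t.
Implicit Types (i j k : int) (n m p : nat).
Local Notation tw := (tw R).

Lemma sigma_nontrivial : exists g : elabC, sigma g != 1%g.
Proof. by exists (1%R : 'Z_2). Qed.

Lemma mul_a_inj k n : injective (mul_a a sigma (m := tw k n)).
Proof. by have [inj _ _] := X_oriented.1 _ (tw k n) _ sigma_nontrivial. Qed.

Lemma apow_mulS k m n (x : X_[tw k n]) :
  apow_mul a (erefl (m.+1 + n)%N) x =
  mul_a a sigma (apow_mul a (erefl (m + n)%N) x).
Proof. by rewrite /apow_mul /tmul /mul_a; exact: XmulA. Qed.

Lemma apow_mul_inj k m n p (e : (m + n)%N = p) :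
  injective (apow_mul a e : X_[tw k n] -> X_[tw k p]).
Proof.
case: p / e; elim: m => [|m IHm] x y; first by rewrite !apow_mul0.
by rewrite !apow_mulS => /mul_a_inj/IHm.
Qed.

Lemma apow_mul1 k n (x : X_[tw k n]) :
  apow_mul a (add1n n) x = mul_a a sigma x.
Proof.
by rewrite (apow_mul_irr a _ (erefl (1 + n)%N)) apow_mulS apow_mul0.
Qed.

(** Multiplication by [a] is injective by exactness, so no further power of [a] is needed to compare
    fractions. *)
Lemma Phi_frac_eq k n m p (e : (m + n)%N = p) (x : X_[tw k n]) (y : X_[tw k p]) :
  Phi_frac a x = Phi_frac a y <-> apow_mul a e x = y.
Proof.
split=> [/pi_eq/frac_eqP|<-]; last first.
  by apply/pi_eq/frac_eqP; exists m, 0%N, p, e, erefl; rewrite /= apow_mul0.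
move=> /= [i [j [q [e1 [e2 E]]]]].
apply: (apow_mul_inj (e := e2)); rewrite -E apow_mul2.
exact: apow_mul_irr.
Qed.

Lemma Phi_frac_inj k n : injective (@Phi_frac R X a k n).
Proof. by move=> x y /(Phi_frac_eq (add0n n)); rewrite apow_mul0. Qed.

Lemma Phi_fracD k n (x y : X_[tw k n]) :
  Phi_frac a (x + y) = Phi_frac a x + Phi_frac a y.
Proof.
rewrite -[RHS]/(Phi_add _ _) Defs.pi_add; apply/(Phi_frac_eq erefl).
by rewrite apow_mulD /=; congr (_ + _); exact: apow_mul_irr.
Qed.

Lemma Phi_fracN k n (x : X_[tw k n]) : Phi_frac a (- x) = - Phi_frac a x.
Proof. by rewrite -[RHS]/(Phi_opp _) Defs.pi_opp. Qed.

Lemma Phi_fracM i j k (e : i + j = k) n m (x : X_[tw i n]) (y : X_[tw j m]) :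
  gr_mul e (Phi_frac a x) (Phi_frac a y) = Phi_frac a (tmul e erefl x y).
Proof. by rewrite /= Defs.pi_mul. Qed.

Lemma Phi_locE k (x : Xgr X elabC k) :
  Phi_loc a k x = Phi_frac a (x : X_[tw k 0]).
Proof. by []. Qed.

(** This is the defining equation [a * Gamma x = t * (x + eps^* x)] divided by [a]. *)
Lemma Phi_loc_Gamma k (e : 1 + k = k + 1) (x : Xgr X elabC k) :
  Phi_loc a _ (Gamma a t x) =
  gr_mul e (Phi_frac a (t : X_[tw 1 1])) (Phi_loc a k (x + Xgr_map X eps k x)).
Proof.
rewrite !Phi_locE Phi_fracM; apply/(Phi_frac_eq (add1n 0)); rewrite apow_mul1.
rewrite (GammaP t x X_oriented.1) /mul_t /tmul /Xmul.
exact: Xmap_ext.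
Qed.

(** * Restriction to the trivial group *)

Lemma res_subproof i k n : i + n%:Z = k ->
  IROpull (one_fun elabC : {multiplicative elab1 -> elabC}) (tw k n) =1
  IROint R elab1 i.
Proof.
by move=> <- x; rewrite [LHS]/= twE /= sign1 intrD addrK.
Qed.
(* Restriction to the trivial group, where [sigma] becomes [1]. *)
Definition res i k n (e : i + n%:Z = k) :
    Defs.hom (El2RO (IROint R elab1 i)) (El2RO (tw k n)) :=
  @Defs.Hom R (El2RO (IROint R elab1 i)) (El2RO (tw k n)) _ (res_subproof e).

Lemma Xone1 : Xone X elab1 = Xunit X.
Proof.
rewrite -[RHS]Xmap_id /Xone; apply: Xmap_ext => x.
by rewrite /= !ord1.
Qed.

(** The restriction factors through the kernel of [sigma], where multiples of [a] vanish by
    exactness. *)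
Lemma res_mul_a i k n (e : i + n.+1%:Z = k) (x : X_[tw k n]) :
  Xmap X (res e) (mul_a a sigma x : X_[tw k n.+1]) = 0.
Proof.
pose f : {multiplicative elab1 -> elab2_ker sigma} := one_fun _.
have fP : IROpull f (IROadd (IROpull (ker_incl sigma) (tw k n))
    (IROint R (elab2_ker sigma) (-1))) =1 IROint R elab1 i.
  move=> z; rewrite -(res_subproof e z) /=.
  by rewrite sign1.
pose g := @Defs.Hom R (El2RO (IROint R elab1 i)) (El2RO _) _ fP.
have -> : Xmap X (res e) (mul_a a sigma x : X_[tw k n.+1]) =
    Xmap X g (Xmap X (hom_ker sigma (tw k n)) (mul_a a sigma x)).
  by rewrite -Xmap_comp; exact: Xmap_ext.
have [_ ker _] := X_oriented.1 _ (tw k n) _ sigma_nontrivial.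
by rewrite (ker _).2 ?raddf0 //; exists x.
Qed.

Fixpoint tpow n : X_[tw n n] :=
  if n is n'.+1 then tmul (esym (intS n')) erefl (t : X_[tw 1 1]) (tpow n')
  else Xone X elabC.

(** Restriction is multiplicative, and the inverse Thom class restricts to 1. *)
Lemma res_tpow n : Xmap X (res (add0r n%:Z)) (tpow n) = Xone X elab1.
Proof.
elim: n => [|n IHn].
  by rewrite /= /Xone -Xmap_comp; apply: Xmap_ext.
rewrite /= /tmul (Xmap_mul _ (IROint_add R (add0r 0)) (g := res (add0r 1))
  (h := res (add0r n%:Z))) //.
rewrite IHn -[RHS](@Xgr1 R X elab1 0 (add0r 0)); congr (Xmul _ _ _).
by rewrite Xone1 -X_oriented.2; exact: Xmap_ext.
Qed.

(** * Polynomials in [u = t/a] without constant term *)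

Let phi := graded_hom_comp (Phi_loc a) (inflation X elabC).
Let u : Phi a 1 := Phi_frac a (t : X_[tw 1 1]).

(** The power [u^n], given as a single fraction so that its numerator can be restricted. *)
Definition upow n : Phi a n := Phi_frac a (tpow n).

Lemma homog_upow0 : homog (upow 0) = homog gr_one.
Proof. by []. Qed.

Lemma homog_upowS n : homog (upow n.+1) = homog_mul (homog u) (homog (upow n)).
Proof. by rewrite -(homogM (esym (intS n))) Phi_fracM. Qed.

(** The shifted index leaves out [u^0]. *)
Let upos_span := graded_span phi (fun n => upow n.+1).

Lemma res_inflation i (s : Xgr X elab1 i) :
  Xmap X (res (addr0 i)) (inflation X elabC i s : X_[tw i 0]) = s.
Proof.
rewrite -[RHS]Xmap_id -Xmap_comp; apply: Xmap_ext => x.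
by rewrite /= !ord1.
Qed.

Lemma res_inflation_tpow i k n (e : i + n%:Z = k) (s : Xgr X elab1 i) :
  Xmap X (res e)
    (tmul e erefl (inflation X elabC i s : X_[tw i 0]) (tpow n)) = s.
Proof.
rewrite /tmul (Xmap_mul _ (IROint_add R (addr0 i)) (g := res (addr0 i))
  (h := res (add0r n%:Z))) //.
rewrite res_tpow res_inflation (XmulC _ (IROint_add R (add0r i))).
exact: Xgr1.
Qed.

(** Polynomials in [u] of degree at most [n] without constant term. The coefficient [s] of [u^n],
    possibly 0, is split off for induction on [n]. *)
Fixpoint upos_bounded n k (p : Phi a k) : Prop :=
  if n is n'.+1 then
    exists s q, upos_bounded n' q /\
      p = gr_mul (subrK n%:Z k) (phi (k - n%:Z) s) (upow n) + q
  else p = 0.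

Lemma upos_boundedD n k (p q : Phi a k) :
  upos_bounded n p -> upos_bounded n q -> upos_bounded n (p + q).
Proof.
elim: n p q => [|n IHn] p q; first by move=> /= -> ->; rewrite addr0.
move=> [s [p' [p'P ->]]] [s' [q' [q'P ->]]].
exists (s + s'), (p' + q'); split; first exact: IHn.
by rewrite raddfD gr_mulDl addrACA.
Qed.

Lemma upos_boundedS n k (p : Phi a k) :
  upos_bounded n p -> upos_bounded n.+1 p.
Proof. by move=> pP; exists 0, p; rewrite raddf0 gr_mul0r add0r. Qed.

Lemma upos_bounded_le n m k (p : Phi a k) :
  (n <= m)%N -> upos_bounded n p -> upos_bounded m p.
Proof.
by move=> /subnK <- pP; elim: (m - n)%N => // l IHl; exact: upos_boundedS.
Qed.

Lemma upos_bounded0 n k : upos_bounded n (0 : Phi a k).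
Proof. exact: upos_bounded_le (leq0n n) _. Qed.

Lemma upos_span_bounded k (p : Phi a k) :
  upos_span p -> exists n, upos_bounded n p.
Proof.
elim=> [|p1 p2 _ [n1 P1] _ [n2 P2]|n i e s].
- by exists 0%N.
- exists (maxn n1 n2); apply: upos_boundedD.
    exact: upos_bounded_le (leq_maxl _ _) P1.
  exact: upos_bounded_le (leq_maxr _ _) P2.
exists n.+1; have ei : i = k - n.+1%:Z by rewrite -e addrK.
exists (gcast ei s), 0; split; first exact: upos_bounded0.
rewrite addr0; apply: homog_inj; rewrite !homogM; congr (homog_mul _ _).
by apply: gh_homog; rewrite homog_gcast.
Qed.

Lemma upos_bounded_frac n k (p : Phi a k) :
  upos_bounded n p -> exists x : X_[tw k n], p = Phi_frac a x.
Proof.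
elim: n p => [|n IHn] p.
  by move=> /= ->; exists 0; rewrite -Phi_locE raddf0.
move=> [s [_ [/IHn[x ->] ->]]].
(* The lower terms have denominator [a^n]; one more factor [a] brings them to the denominator of the
   top term. *)
exists (tmul (subrK _ k) erefl (inflation X elabC _ s : X_[tw _ 0])
  (tpow n.+1) + mul_a a sigma x : X_[tw k n.+1]).
rewrite Phi_fracD; congr (_ + _).
  exact: Phi_fracM.
by apply/(Phi_frac_eq (add1n n)); rewrite apow_mul1.
Qed.

(* The top coefficient of a polynomial in [u] lying in [X(C)_*] vanishes:
   after clearing denominators it is its restriction to the trivial group. *)
Lemma upos_bounded_loc n k (x : Xgr X elabC k) :
  upos_bounded n (Phi_loc a k x) -> Phi_loc a k x = 0.
Proof.
elim: n => [//|n IHn] [s [q [qP E]]].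
have [y qE] := upos_bounded_frac qP.
suff s0 : s = 0 by apply: IHn; rewrite E s0 raddf0 gr_mul0r add0r.
rewrite -(res_inflation_tpow (subrK n.+1%:Z k) s).
(* The fraction [(a^n x - y) / a^n] is the top term [s u^n.+1]. Comparing numerators shows that
   [s t^n.+1] is a multiple of [a], so it restricts to 0. *)
have /(Phi_frac_eq (add1n n)) :
    Phi_frac a (apow_mul a (addn0 n) (x : X_[tw k 0]) - y) =
    Phi_frac a (tmul (subrK _ k) erefl (inflation X elabC _ s : X_[tw _ 0])
      (tpow n.+1)).
  rewrite Phi_fracD Phi_fracN -qE.
  rewrite -(_ : Phi_frac a (x : X_[tw k 0]) = Phi_frac a _); last first.
    by apply/(Phi_frac_eq (addn0 n)).
  by rewrite -Phi_locE E addrK; exact: Phi_fracM.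
by rewrite apow_mul1 => <-; exact: res_mul_a.
Qed.

(** As [Phi_loc] is injective, this gives the trivial intersection assumed in
    [graded_basis_lift]. *)
Lemma upos_span_loc k (x : Xgr X elabC k) :
  upos_span (Phi_loc a k x) -> x = 0.
Proof.
move=> /upos_span_bounded[n /upos_bounded_loc x0].
by apply: (@Phi_frac_inj k 0); rewrite -[LHS]Phi_locE x0 -[RHS]Phi_locE raddf0.
Qed.

(** * Iterates of [Gamma] modulo positive powers of [u] *)

Lemma upos_span_mulu k l (e : 1 + k = l) (p : Phi a k) :
  upos_span p -> upos_span (gr_mul e u p).
Proof.
move=> pP; elim: pP e => [|p1 p2 _ IH1 _ IH2|n i e' s] e.
- by rewrite gr_mulr0; exact: graded_span0.
- by rewrite gr_mulDr; apply: graded_spanD; [exact: IH1|exact: IH2].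
- apply: (graded_span_homog (b := n.+1) (s := s)).
  rewrite !homogM (homog_upowS n.+1) !homog_mulA.
  by rewrite (homog_mulC (homog u)).
Qed.

(** The map [eps] factors through the trivial group, so [eps^* x] is a scalar from [X(1)_*]. *)
Lemma Phi_loc_eps k (x : Xgr X elabC k) :
  Phi_loc a k (Xgr_map X eps k x) =
  phi k (Xgr_map X (one_fun elabC : {multiplicative elab1 -> elabC}) k x).
Proof. by congr (Phi_loc a k _); rewrite /= -Xmap_comp; exact: Xmap_ext. Qed.

Lemma iter_Gamma_upow n k (x : Xgr X elabC k) :
  exists2 p, upos_span p &
    homog (Phi_loc a _ (iter_Gamma a t n x) - p) =
    homog_mul (homog (upow n)) (homog (Phi_loc a k x)).
Proof.
elim: n => [|n [p pP pE]].
  exists 0; first exact: graded_span0.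
  by rewrite subr0 homog_upow0 homog_mul1.
have e : 1 + iter_degree n k = iter_degree n.+1 k := addrC _ _.
set w := iter_Gamma a t n x in pE *.
(* Since [Gamma w] is [u w + u eps^* w] in [Phi], subtracting this correction leaves [u] times the
   previous difference. The summand [u eps^* w] is a scalar multiple of [u]. *)
exists (gr_mul e u (p + Phi_loc a _ (Xgr_map X eps _ w))).
  rewrite gr_mulDr; apply: graded_spanD; first exact: upos_span_mulu.
  rewrite Phi_loc_eps; set s := Xgr_map _ _ _ _.
  apply: (graded_span_homog (b := 0) (s := s)).
  by rewrite homogM homog_upowS homog_upow0 Monoid.mulm1 homog_mulC.
rewrite [Phi_loc a _ _](Phi_loc_Gamma e w) raddfD -gr_mulrN -gr_mulDr.
rewrite opprD addrACA subrr addr0.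
by rewrite homogM pE homog_upowS homog_mulA.
Qed.
End Oriented.

(** * Monomials in the [y_i] and one extra variable *)

Section Multisets.
Variable I : choiceType.
Implicit Types (n : nat) (M : {mset I}).

(** The multiset of the monomial [u^n y^M], with [None] indexing [u]. *)
Definition mset_option n M : {mset option I} :=
  seq_mset (nseq n None ++ [seq Some i | i <- enum_mset M]).

Lemma mset_optionN n M : mset_option n M None = n.
Proof.
rewrite /mset_option mset_seqE count_cat count_nseq mul1n count_map.
by rewrite (@eq_count _ _ pred0) ?count_pred0 ?addn0.
Qed.

Lemma mset_optionS n M i : mset_option n M (Some i) = M i.
Proof.
rewrite /mset_option mset_seqE count_cat count_nseq mul0n count_map.
by rewrite -count_mem_mset.
Qed.

Lemma mset_option_inj n n' M M' :
  mset_option n M = mset_option n' M' -> n = n' /\ M = M'.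
Proof.
move=> E; split; first by rewrite -(mset_optionN n M) E mset_optionN.
by apply/msetP => i; rewrite -(mset_optionS n M) E mset_optionS.
Qed.

Lemma mset_option_surj (N : {mset option I}) : exists n M, N = mset_option n M.
Proof.
exists (N None), (seq_mset (pmap id (enum_mset N))); apply/msetP => -[i|].
  rewrite mset_optionS mset_seqE -count_mem_mset.
  by elim: (enum_mset N) => [//|[j|] s IHs] /=; rewrite IHs.
by rewrite mset_optionN.
Qed.

Lemma mset_size0 M : size (enum_mset M) = 0%N -> M = mset0.
Proof.
by move=> /size0nil M0; apply/msetP => i; rewrite -!count_mem_mset M0 enum_mset0.
Qed.
End Multisets.

(** A multiset built from a list enumerates to it only up to permutation, which commutativity of
    [homog_mul] absorbs. *)
Lemma homog_mset_option (R : realType) (X : el2RO_algebra R)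
    (a : X (El2RO (IROsub (IROint R elabC 0) sigma)))
    (t : X (El2RO (IROsub (IROint R elabC 1) sigma)))
    (I : choiceType) (d : I -> int) (y : forall i : I, Xgr X elabC (d i)) n M :
  homog (monomial (generator a t y) (mset_option n M)) =
  homog_mul (homog (upow a t n)) (homog (Phi_loc a _ (monomial y M))).
Proof.
rewrite homog_prod_seq (perm_big _ (perm_eq_seq_mset _)) big_cat big_map.
congr (homog_mul _ _); last by rewrite /monomial /mdegree gh_prod_seq.
elim: n => [|n IHn]; first by rewrite big_nil.
by rewrite big_cons IHn homog_upowS.
Qed.

(** * From the monomial basis of [Phi] to the basis of [X(C)_*] *)

Theorem corollary9p3 (R : realType) (X : el2RO_algebra R)
    (a : X (El2RO (IROsub (IROint R elabC 0) sigma)))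
    (t : X (El2RO (IROsub (IROint R elabC 1) sigma)))
    (X_oriented : oriented a t)
    (X_connected : graded_connected X)
    (I : choiceType) (d : I -> int) (d_gt0 : forall i : I, 0 < d i)
    (y : forall i : I, Xgr X elabC (d i))
    (Phi_polynomial :
      polynomial_algebra_on
        (graded_hom_comp (Phi_loc a) (inflation X elabC))
        (generator a t y)) :
  graded_basis (inflation X elabC) (basis_class a t y).
Proof.
(* Bijectivity of polynomial evaluation is unique existence of coefficients. *)
have basis : graded_basis (graded_hom_comp (Phi_loc a) (inflation X elabC))
    (monomial (generator a t y)).
  move=> k x; have [c cK Kc] := Phi_polynomial k.
  by exists (c x); split=> [|c' <-]; [exact: Kc|exact: cK].
have prod0 : homog (Phi_loc a _ (monomial y mset0)) = homog gr_one.
  by rewrite /monomial /mdegree enum_mset0 /= (gh_one (Phi_loc a)).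
(* [h] gives the monomial that a basis class equals modulo positive powers of [u], and [g n] is the
   monomial [u^n.+1]. Nonemptiness of [M] keeps their images disjoint. *)
pose h (b : basis_index I) : {mset option I} :=
  if b is Some (n, M) then mset_option n (val M) else mset_option 0 mset0.
pose g n : {mset option I} := mset_option n.+1 mset0.
have M_neq0 (M : {M : {mset I} | (0 < size (enum_mset M))%N}) : val M <> mset0.
  by case: M => M /= /[swap] ->; rewrite enum_mset0.
apply: (graded_basis_lift (z := fun n => upow a t n.+1) (g := g) (h := h) basis).
- move=> [[n M]|] [[n' M']|] //= /mset_option_inj[].
  + by move=> -> /val_inj ->.
  + by move=> _ /M_neq0.
  + by move=> _ /esym/M_neq0.
- move=> n [[m M]|]; apply/eqP => /mset_option_inj[] //.
  by move=> _ /M_neq0.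
- move=> b; have [n [M ->]] := mset_option_surj b.
  (* For empty [M] the monomial is [u^n]: the class 1 if [n = 0], a value of [g] otherwise. *)
  have [/mset_size0 ->|M_gt0] := posnP (size (enum_mset M)); last first.
    by left; exists (Some (n, exist _ M M_gt0)).
  by case: n => [|n]; [left; exists None|right; exists n].
- by move=> n; rewrite homog_mset_option prod0 Monoid.mulm1.
- by move=> k x; exact: upos_span_loc.
case=> [[n M]|]; last first.
  exists 0; first exact: graded_span0.
  by rewrite homog_mset_option prod0 subr0 (gh_one (Phi_loc a)) homog_mul1.
have [p pP pE] := iter_Gamma_upow X_oriented n (monomial y (val M)).
by exists p => //; rewrite homog_mset_option pE.
Qed.
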